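(* In an ISI channel with memory length $\nu$, transmission block length $L$, data rate $R$, and a zero-forcing (ZF) SC-FDE receiver, the diversity gain is always $1$, i.e., $P_{\rm err}(R,\nu,L)\doteq {\sf SNR}^{-1}$.
   Context: Here $\nu\ge 1$ and $L\ge \nu+1$ are fixed integers, $R>0$ is a fixed rate, and ${\sf SNR}>0$ is a real parameter tending to infinity. Channel: $h_0,\dots,h_\nu$ are i.i.d. circularly symmetric complex Gaussian $\mathcal{CN}(0,1)$, constant over a block of length $L$. After cyclic-prefix processing, the received block is $y=\sqrt{\sf SNR}\,H_{\rm eq}x+n$, where $x=(x(L),\dots,x(1))^T$ is the transmitted block with entries of average power 1, $n$ is complex Gaussian noise with zero mean and covariance $I$, independent of the channel and of $x$, and $H_{\rm eq}$ is the $L\times L$ circulant matrix with first row $(h_0,\dots,h_\nu,0,\dots,0)$, each following row being the cyclic right shift of the previous one. ZF SC-FDE receiver: $W=H_{\rm eq}^{-1}$ (defined almost surely), with output $\tilde y=Wy=\sqrt{\sf SNR}\,x+H_{\rm eq}^{-1}n=(\tilde y(L),\dots,\tilde y(1))^T$. Pairwise error: transmission is at rate $R$ with symbols from a finite constellation, not depending on ${\sf SNR}$, of $2^R$ points (uncoded transmission). $P_{\rm err}(R,\nu,L)$ is the average pairwise error probability, i.e. the probability that the receiver decides in favor of $s_k$ when a different symbol $s_j$ was transmitted as $x(\ell)$, averaged over the channel: $P_{\rm err}(R,\nu,L)=\mathbb{E}_H\big\{P\big[|\tilde y(\ell)-\sqrt{\sf SNR}\,s_j|>|\tilde y(\ell)-\sqrt{\sf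 SNR}\,s_k|\;\big|\;H\big]\big\}$. The diversity gain is $-\lim_{{\sf SNR}\to\infty}\frac{\log P_{\rm err}(R,\nu,L)}{\log{\sf SNR}}$. Exponential equality: $f({\sf SNR})\doteq g({\sf SNR})$ means $\lim_{{\sf SNR}\to\infty}\frac{\log f}{\log{\sf SNR}}=\lim_{{\sf SNR}\to\infty}\frac{\log g}{\log{\sf SNR}}$. *)

(* Defs.v *)
From HB Require Import structures.
From mathcomp Require Import all_boot all_order all_algebra.
From mathcomp Require Import all_classical all_reals all_analysis.
From mathcomp Require Import complex.

Set Implicit Arguments.
Unset Strict Implicit.
Unset Printing Implicit Defensive.

Import Order.TTheory GRing.Theory Num.Theory.
Import numFieldNormedType.Exports.

Local Open Scope classical_set_scope.
Local Open Scope ring_scope.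
Local Open Scope complex_scope.

(* Borel sigma-algebra of R[i], transported from the product R * R. *)
Section measurable_complex.
Variable R : realType.

Definition pair_of_complex (z : R[i]) : R * R := (complex.Re z, complex.Im z).

Definition measurable_complex : set (set R[i]) :=
  preimage_set_system setT pair_of_complex measurable.

Let sigma_algebra_complex : sigma_algebra setT measurable_complex.
Proof. exact/sigma_algebra_preimage/sigma_algebra_measurable. Qed.

Let measurable_complex0 : measurable_complex set0.
Proof. by case: sigma_algebra_complex. Qed.

Let measurable_complexC A :
  measurable_complex A -> measurable_complex (~` A).
Proof. by rewrite -setTD; case: sigma_algebra_complex => _ + _; apply. Qed.

Let measurable_complexU (F : (set R[i])^nat) :
  (forall i, measurable_complex (F i)) -> measurable_complex (\bigcup_i F i).
Proof. by case: sigma_algebra_complex => _ _; apply. Qed.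

HB.instance Definition _ := isPointed.Build R[i] 0.
HB.instance Definition _ :=
  @isMeasurable.Build default_measure_display R[i] measurable_complex
    measurable_complex0 measurable_complexC measurable_complexU.

End measurable_complex.

(* Law of a + i b, with a and b independent real N(0, 1/2); normal_prob takes
   the standard deviation, not the variance. *)
Definition CN01 (R : realType) : set R[i] -> \bar R :=
  let N := normal_prob (0 : R) (Num.sqrt 2^-1) in
  pushforward (N \x N)%E (fun p : R * R => p.1 +i* p.2).

Section probability_notions.
Context (R : realType) (d : measure_display) (T : measurableType d).
Variable P : probability T R.

Definition independent d1 d2 (S1 : measurableType d1) (S2 : measurableType d2)
    (X : T -> S1) (Y : T -> S2) : Prop :=
  forall (A : set S1) (B : set S2), measurable A -> measurable B ->
    P (X @^-1` A `&` Y @^-1` B) = (P (X @^-1` A) * P (Y @^-1` B))%E.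

Definition mutually_independent d1 (S : measurableType d1) (I : finType)
    (X : I -> T -> S) : Prop :=
  forall (J : {set I}) (A : I -> set S), (forall i, measurable (A i)) ->
    P [set w | forall i, i \in J -> A i (X i w)] =
    (\prod_(i in J) P (X i @^-1` A i))%E.

Definition iid_CN01 m (v : T -> m.-tuple R[i]) : Prop :=
  mutually_independent (fun (i : 'I_m) w => tnth (v w) i) /\
  forall (i : 'I_m) (B : set R[i]), measurable B ->
    P [set w | B (tnth (v w) i)] = CN01 B.

(* f \o X is a version of the conditional probability of A given X under
   P( . | E), i.e. of P[A | X, E]; both sides are multiplied by P(E). *)
Definition is_cond_prob d1 (S : measurableType d1)
    (A E : set T) (X : T -> S) (f : S -> R) : Prop :=
  [/\ measurable_fun setT f,
      forall u, 0 <= f u &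
      forall B : set S, measurable B ->
        (\int[P]_(w in E `&` X @^-1` B) (f (X w))%:E)%E =
        P (A `&` (E `&` X @^-1` B))].

(* The choice of a version is immaterial: if P(E) > 0, two versions agree
   almost everywhere for the law of X under P( . | E). *)
Definition cond_prob d1 (S : measurableType d1)
    (A E : set T) (X : T -> S) : S -> R :=
  xget (cst 0) [set f : S -> R | is_cond_prob A E X f].

End probability_notions.

Section zf_sc_fde.
Context (R : realType) (nu L : nat).
Implicit Types (snr : R) (h : nu.+1.-tuple R[i]) (x n : L.-tuple R[i]).

(* nth returns its default 0 beyond h_nu. *)
Definition Heq h : 'M[R[i]]_L :=
  \matrix_(i < L, j < L) nth 0 h ((j + L - i) %% L)%N.

(* Times are shifted by one: tnth x t is x(t+1), for t = 0, ..., L-1, and sits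
   in row L-1-t of (x(L), ..., x(1))^T. *)
Definition block x : 'cV[R[i]]_L := \col_i tnth x (rev_ord i).

Definition received snr h x n : 'cV[R[i]]_L :=
  (Num.sqrt snr)%:C *: (Heq h *m block x) + \col_i tnth n i.

(* For singular A, invmx A = A; Heq h is a.s. invertible when h is i.i.d. CN(0,1)
   and nu < L, so this convention only matters on a null set. *)
Definition zf_output snr h x n : 'cV[R[i]]_L :=
  invmx (Heq h) *m received snr h x n.

Definition zf_symbol snr h x n (l : 'I_L) : R[i] :=
  zf_output snr h x n (rev_ord l) 0.

Context (d : measure_display) (T : measurableType d) (P : probability T R).

Definition pairwise_error snr (h : T -> nu.+1.-tuple R[i])
    (x n : T -> L.-tuple R[i]) (l : 'I_L) (a b : R[i]) : set T :=
  [set w | let y := zf_symbol snr (h w) (x w) (n w) l in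
           `|y - (Num.sqrt snr)%:C * b| < `|y - (Num.sqrt snr)%:C * a| ].

(* Expectation over the channel of P[error | H, x(l) = a]. *)
Definition Perr (h : T -> nu.+1.-tuple R[i]) (x n : T -> L.-tuple R[i])
    (l : 'I_L) (a b : R[i]) (snr : R) : R :=
  fine 'E_P[fun w => cond_prob P (pairwise_error snr h x n l a b)
                       [set w | tnth (x w) l = a] h (h w)].

End zf_sc_fde.

Section exponential_order.
Context (R : realType).

Definition exponential_order (f : R -> R) (a : R) : Prop :=
  ln (f snr) / ln snr @[snr --> +oo] --> a.

Definition exponentially_equal (f g : R -> R) : Prop :=
  exists a : R, exponential_order f a /\ exponential_order g a.

Definition diversity_gain (f : R -> R) (g : R) : Prop :=
  exponential_order f (- g).

End exponential_order.

(* Main.v *)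
(** With [t := sqrt SNR] and [v := H^-1 n], an error means that [v(l)] is closer
    to [- t (s_j - s_k)] than to [0]; everything is governed by the size of the
    row of [H^-1] that yields [v(l)].

    The eigenvectors of the circulant [H] are fixed vectors (the powers of an
    [L]-th root of unity [w]) with eigenvalues [sum_m h_m w^m], and each
    eigenvalue [h_0 + (independent rest)] lies in a disc of radius [r] with
    probability of order [r^2].

    Upper bound: unless some noise coordinate exceeds [a := sqrt (2 ln SNR)],
    an event of probability [O(1/SNR)], an error forces some eigenvalue into a
    disc of radius [O(a/t)]; hence the error probability is [O(ln SNR / SNR)].

    Lower bound: [H^-1] maps the all-ones vector to itself divided by the
    eigenvalue at [w = 1], so the row has l1-norm at least [1/|sum_m h_m|]. When
    [|sum_m h_m| < 2/(t |s_j - s_k|)], an event of probability at least [c/SNR],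
    each noise coordinate has a fixed positive chance to lie in the unit square,
    of the quadrant dictated by the row, in which all contributions push [v(l)]
    in the direction of an error. *)

Require Import Defs.
From HB Require Import structures.
From mathcomp Require Import all_boot all_order all_algebra.
From mathcomp Require Import all_classical all_reals all_analysis.
From mathcomp Require Import complex.
From mathcomp Require Import measurable_realfun ring lra.
From mathcomp Require separable cyclotomic.

Set Implicit Arguments.
Unset Strict Implicit.
Unset Printing Implicit Defensive.

Import Order.TTheory GRing.Theory Num.Theory.
Import numFieldNormedType.Exports.

Local Open Scope classical_set_scope.
Local Open Scope ring_scope.
Local Open Scope complex_scope.

(** * Circulant matrices *)

Section circulant.
Variables (R : realType) (nu L : nat).
Hypothesis nuL : (nu < L)%N.
Local Notation C := R[i].
Implicit Types (h : nu.+1.-tuple C) (w : C).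

(** The transfer function of the channel; at the [L]-th roots of unity it gives the eigenvalues of
    the circulant. *)
Definition spectrum h w : C := \sum_(m < nu.+1) tnth h m * w ^+ m.

(** Row [i] is the first row shifted by [i], so shifting the column index back by [i] modulo [L]
    pulls out the factor [w ^+ i]; exponents may be reduced modulo [L] because [w ^+ L = 1]. *)
Lemma Heq_eigen h w : w ^+ L = 1 ->
  Heq L h *m (\col_i w ^+ i) = spectrum h w *: \col_i w ^+ i.
Proof.
move=> wL; have L0 : (0 < L)%N by exact: leq_ltn_trans nuL.
have wmod a : w ^+ (a %% L) = w ^+ a by rewrite [in RHS](divn_eq a L) exprD
  mulnC exprM wL expr1n mul1r.
apply/matrixP => i z; rewrite !mxE.
under eq_bigr do rewrite !mxE.
pose sh (j : 'I_L) : 'I_L := Ordinal (ltn_pmod (j + i) L0).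
pose sh' (j : 'I_L) : 'I_L := Ordinal (ltn_pmod (j + L - i) L0).
have shK : cancel sh sh'.
  move=> j; apply: val_inj => /=.
  have iL := ltnW (ltn_ord i).
  by rewrite -addnBA// modnDml -addnA subnKC// modnDr modn_small.
rewrite (reindex sh); last first.
  exists sh' => // j _; apply: val_inj => /=.
  have iL := ltnW (ltn_ord i).
  by rewrite modnDml subnK ?modnDr ?modn_small// (leq_trans iL)// leq_addl.
rewrite [in RHS]mulr_suml.
transitivity (\sum_(m < nu.+1) nth 0 h m * w ^+ m * w ^+ i); last first.
  by apply: eq_bigr => m _; rewrite (tnth_nth 0).
(* Since [nu < L], the taps fit in one row; the added indices beyond [nu] meet the default [0] of
   [nth]. *)
rewrite (big_ord_widen L (fun m => nth 0 h m * w ^+ m * w ^+ i))//.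
rewrite [RHS]big_mkcond; apply: eq_bigr => j _ /=.
have -> : (((j + i) %% L + L - i) %% L)%N = j.
  by have /(congr1 val) := shK j.
rewrite wmod exprD mulrA.
case: ltnP => // jnu; rewrite nth_default ?size_tuple// !mul0r//.
Qed.

(** ['X^L - 1] splits over the algebraically closed field and is separable in characteristic
    zero. *)
Lemma roots_of_unity : exists r : 'I_L -> C, injective r /\
  forall k, r k ^+ L = 1.
Proof.
have L0 : (0 < L)%N by exact: leq_ltn_trans nuL.
have [r Dp] := closed_field_poly_normal ('X^L - 1 : {poly C}).
move: Dp; rewrite lead_coefXnsubC// scale1r => Dp.
have sz : size r = L by apply: succn_inj;
  rewrite -(size_prod_XsubC r id) -Dp size_XnsubC.
have Ur : uniq r.
  by rewrite -separable.separable_prod_XsubC -Dp cyclotomic.separable_Xn_sub_1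
    // pnatr_eq0 -lt0n.
exists (fun k => nth 0 r k); split.
  by move=> a b /eqP; rewrite nth_uniq ?sz ?ltn_ord// => /eqP/val_inj.
move=> k; have : root (\prod_(z <- r) ('X - z%:P)) (nth 0 r k).
  by rewrite root_prod_XsubC mem_nth ?sz.
by rewrite -Dp rootE !hornerE subr_eq0 => /eqP.
Qed.

(** The columns of the Vandermonde matrix of the roots are the eigenvectors, independent because the
    roots are distinct. That [F] is chosen before [h] is what makes later bounds uniform in the
    channel. *)
Lemma Heq_diag : exists (r : 'I_L -> C) (F : 'M[C]_L),
  [/\ forall k, r k ^+ L = 1, F \in unitmx &
      forall h, Heq L h = F *m diag_mx (\row_k spectrum h (r k)) *m invmx F].
Proof.
have [r [ri r1]] := roots_of_unity.
pose F := Vandermonde L (\row_k r k).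
have uF : F \in unitmx.
  rewrite unitmxE det_Vandermonde unitfE; apply/prodf_neq0 => i _.
  apply/prodf_neq0 => j ij; rewrite !mxE subr_eq0;
    apply: contraTN ij => /eqP/ri ->.
  by rewrite ltnn.
exists r, F; split=> // h; apply: (canRL (mulmxK uF)).
apply/matrixP => i k.
have /matrixP/(_ i ord0) := Heq_eigen h (r1 k); rewrite !mxE => E.
transitivity (\sum_j Heq L h i j * (\col_i r k ^+ i) j (ord0 : 'I_1)).
  by apply: eq_bigr => j _; rewrite !mxE.
rewrite E (bigD1 k)//= !mxE eqxx mulr1n mulrC big1 ?addr0// => j jk.
by rewrite !mxE (negbTE jk) mulr0n mulr0.
Qed.

End circulant.

(** * Bounds on the inverse of a circulant matrix *)

Section circulant_norm.
Import Normc.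
Variables (R : realType).
Local Notation C := R[i].

Lemma normCE (z : C) : `|z| = (normc z)%:C.
Proof. by case: z. Qed.

Lemma normc_ge0 (z : C) : 0 <= normc z.
Proof. by rewrite -lecR -normCE; apply: normr_ge0. Qed.

Lemma normc_sum (I : Type) (s : seq I) (F : I -> C) :
  normc (\sum_(i <- s) F i) <= \sum_(i <- s) normc (F i).
Proof.
elim/big_ind2: _ => //; first by rewrite normc0.
by move=> x1 y1 x2 y2 a b; apply: (le_trans (le_normcD _ _)); rewrite lerD.
Qed.

Variables (nu L : nat).
Hypothesis nuL : (nu < L)%N.
Implicit Types (h : nu.+1.-tuple C) (w : C).

(* [K] does not depend on [h], because the eigenvectors of [Heq L h] do not. *)
Lemma invmx_Heq_norm : exists (r : 'I_L -> C) (K : R),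
  [/\ 0 < K, forall k, r k ^+ L = 1 &
  forall h (rho : R), 0 < rho -> (forall k, rho <= normc (spectrum h (r k))) ->
  Heq L h \in unitmx /\
  forall (v : 'cV[C]_L) i,
    normc ((invmx (Heq L h) *m v) i 0) <= K / rho * \sum_j normc (v j 0)].
Proof.
have [r [F [r1 uF HE]]] := Heq_diag R nuL.
(* The triple sum dominates the contribution of every single entry of the inverse; the [1] only
   ensures [0 < K]. *)
pose K : R := 1 + \sum_i \sum_j \sum_k normc (F i k * invmx F k j).
have K0 : 0 < K.
  rewrite ltr_pwDl// sumr_ge0// => i _; rewrite sumr_ge0// => k _.
  by rewrite sumr_ge0// => j _; exact: normc_ge0.
exists r, K; split=> // h rho rho0 Hrho.
have ln0 k : spectrum h (r k) != 0.
  by apply: contraTneq rho0 => l0; have := Hrho k; rewrite l0 normc0 -leNgt.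
have HinvE : Heq L h *m (F *m diag_mx (\row_k (spectrum h (r k))^-1) *m invmx
  F) = 1%:M.
  rewrite HE !mulmxA mulmxKV// -(mulmxA F) mulmx_diag.
  rewrite (_ : \row__ _ = const_mx 1) ?diag_const_mx ?mulmx1 ?mulmxV//.
  by apply/rowP => k; rewrite !mxE mulfV.
have [uH _] := mulmx1_unit HinvE; split=> // v i.
have -> : invmx (Heq L h) = F *m diag_mx (\row_k (spectrum h (r k))^-1) *m
  invmx F.
  by rewrite -[RHS](mulKmx uH) HinvE mulmx1.
rewrite mxE (le_trans (normc_sum _ _))// mulr_sumr ler_sum// => j _.
rewrite normcM ler_wpM2r ?normc_ge0// mxE (le_trans (normc_sum _ _))//.
apply: (@le_trans _ _ (\sum_k (normc (F i k * invmx F k j) / rho))).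
  rewrite ler_sum// => k _; rewrite mul_mx_diag !mxE mulrAC normcM ler_wpM2l
    ?normc_ge0//.
  by rewrite normcV lef_pV2 ?posrE// (lt_le_trans rho0).
rewrite -mulr_suml ler_wpM2r ?invr_ge0 ?(ltW rho0)//.
have le_sum n (f : 'I_n -> R) m : (forall j, 0 <= f j) -> f m <= \sum_j f j.
  by move=> f0; rewrite (bigD1 m)//= lerDl sumr_ge0.
apply: (@le_trans _ _ (\sum_j \sum_k normc (F i k * invmx F k j))).
  apply: (le_sum _ (fun j => \sum_k normc (F i k * invmx F k j))) => m.
  by rewrite sumr_ge0// => k _; exact: normc_ge0.
rewrite /K ler_wpDl//; apply: (le_sum _ (fun i =>
  \sum_j \sum_k normc (F i k * invmx F k j))).
by move=> m; rewrite sumr_ge0// => k _; rewrite sumr_ge0// => p _;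
  exact: normc_ge0.
Qed.

(** The all-ones vector [e] is the eigenvector for the root [1], so [e] equals [spectrum h 1] times
    the inverse applied to [e]; the triangle inequality in row [i] concludes. *)
Lemma invmx_Heq_row_lb h i : Heq L h \in unitmx ->
  1 <= normc (spectrum h 1) * \sum_j normc (invmx (Heq L h) i j).
Proof.
move=> uH; pose e : 'cV[C]_L := \col_i 1 ^+ i.
have := Heq_eigen nuL h (expr1n C L);
  rewrite -/e => /(congr1 (mulmx (invmx (Heq L h)))).
rewrite mulKmx// -scalemxAr => /matrixP/(_ i 0); rewrite !mxE expr1n => E.
rewrite -[X in X <= _](@normc1 R) [X in normc X <= _]E normcM ler_wpM2l
  ?normc_ge0//.
apply: (le_trans (normc_sum _ _)); rewrite ler_sum// => j _.
by rewrite !mxE expr1n mulr1.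
Qed.

End circulant_norm.

(** * Measurability of complex-valued functions *)

Section measurable_complex_fun.
Import Normc.
Context (R : realType) (d : measure_display) (T : measurableType d).
Local Notation C := R[i].
Implicit Types f g : T -> C.

(** The sigma-algebra of [R[i]] is the preimage of the product one under [pair_of_complex]. *)
Lemma measurable_complexP f : measurable_fun setT f <->
  measurable_fun setT (fun w => complex.Re (f w)) /\
  measurable_fun setT (fun w => complex.Im (f w)).
Proof.
have -> : measurable_fun setT f <-> measurable_fun setT (@pair_of_complex R \o
  f).
  split=> mf _ B.
    move=> mB; have := mf measurableT (@pair_of_complex R @^-1` B).
    by rewrite -comp_preimage; apply; exists B => //; rewrite setTI.
  by case=> A mA <-; rewrite setTI -comp_preimage; exact: mf.
exact: measurable_fun_pairP.
Qed.

Lemma measurable_cplx f :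
  measurable_fun setT (fun w => complex.Re (f w)) ->
  measurable_fun setT (fun w => complex.Im (f w)) -> measurable_fun setT f.
Proof. by move=> *; apply/measurable_complexP. Qed.

Lemma measurable_Re f : measurable_fun setT f ->
  measurable_fun setT (fun w => complex.Re (f w)).
Proof. by case/measurable_complexP. Qed.

Lemma measurable_Im f : measurable_fun setT f ->
  measurable_fun setT (fun w => complex.Im (f w)).
Proof. by case/measurable_complexP. Qed.

Lemma measurable_cadd f g : measurable_fun setT f -> measurable_fun setT g ->
  measurable_fun setT (fun w => f w + g w).
Proof.
move=> mf mg; apply: measurable_cplx.
  rewrite (_ : (fun _ => _) = (fun w => complex.Re (f w)) \+ (fun w =>
    complex.Re (g w))).
    by apply: measurable_funD; exact: measurable_Re.
  by apply/funext => w /=; case: (f w) (g w) => [a b] [c e].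
rewrite (_ : (fun _ => _) = (fun w => complex.Im (f w)) \+ (fun w =>
  complex.Im (g w))).
  by apply: measurable_funD; exact: measurable_Im.
by apply/funext => w /=; case: (f w) (g w) => [a b] [c e].
Qed.

Lemma measurable_cmul f g : measurable_fun setT f -> measurable_fun setT g ->
  measurable_fun setT (fun w => f w * g w).
Proof.
move=> mf mg.
have [mRf mIf] := (measurable_Re mf, measurable_Im mf).
have [mRg mIg] := (measurable_Re mg, measurable_Im mg).
apply: measurable_cplx.
  rewrite (_ : (fun _ => _) = ((fun w => complex.Re (f w)) \* (fun w =>
    complex.Re (g w)))
    \- ((fun w => complex.Im (f w)) \* (fun w => complex.Im (g w)))).
    by apply: measurable_funB; exact: measurable_funM.
  by apply/funext => w /=; case: (f w) (g w) => [a b] [c e].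
rewrite (_ : (fun _ => _) = ((fun w => complex.Re (f w)) \* (fun w =>
  complex.Im (g w)))
  \+ ((fun w => complex.Im (f w)) \* (fun w => complex.Re (g w)))).
  by apply: measurable_funD; exact: measurable_funM.
by apply/funext => w /=; case: (f w) (g w) => [a b] [c e].
Qed.

Lemma measurable_csum (I : Type) (s : seq I) (P : pred I) (F : I -> T -> C) :
  (forall i, measurable_fun setT (F i)) ->
  measurable_fun setT (fun w => \sum_(i <- s | P i) F i w).
Proof.
move=> mF; elim: s => [|i s IH]; first (under eq_fun do rewrite big_nil;
  exact: measurable_cst).
under eq_fun do rewrite big_cons; case: (P i) => //;
  exact: measurable_cadd (mF i) IH.
Qed.

Lemma measurable_cprod (I : Type) (s : seq I) (P : pred I) (F : I -> T -> C) :
  (forall i, measurable_fun setT (F i)) ->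
  measurable_fun setT (fun w => \prod_(i <- s | P i) F i w).
Proof.
move=> mF; elim: s => [|i s IH]; first (under eq_fun do rewrite big_nil;
  exact: measurable_cst).
under eq_fun do rewrite big_cons; case: (P i) => //;
  exact: measurable_cmul (mF i) IH.
Qed.

Lemma measurable_sqrnormc f : measurable_fun setT f ->
  measurable_fun setT (fun w => (complex.Re (f w)) ^+ 2 + (complex.Im (f w)) ^+
    2).
Proof.
move=> mf; apply: measurable_funD; apply: measurable_funX.
- exact: measurable_Re.
- exact: measurable_Im.
Qed.

Lemma measurable_normc f : measurable_fun setT f ->
  measurable_fun setT (fun w => normc (f w)).
Proof.
move=> mf.
rewrite (_ : (fun _ => _) = (fun w => ((complex.Re (f w)) ^+ 2 + (complex.Im (f
  w)) ^+ 2) `^ 2^-1)).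
  exact/(measurableT_comp (measurable_powR _))/measurable_sqrnormc.
apply/funext => w; rewrite powR12_sqrt ?addr_ge0 ?sqr_ge0//.
by case: (f w).
Qed.

(** The inverse is the conjugate divided by the squared modulus; the division is written as the real
    power [-1], which agrees with the inverse at [0] too. *)
Lemma measurable_cinv f : measurable_fun setT f ->
  measurable_fun setT (fun w => (f w)^-1).
Proof.
move=> mf; pose n w := ((complex.Re (f w)) ^+ 2 + (complex.Im (f w)) ^+ 2) `^
  (-1).
have mn : measurable_fun setT n.
  exact/(measurableT_comp (measurable_powR _))/measurable_sqrnormc.
apply: measurable_cplx.
  rewrite (_ : (fun _ => _) = (fun w => complex.Re (f w)) \* n).
    by apply: measurable_funM => //; exact: measurable_Re.
  apply/funext => w; rewrite /n /= powR_inv1 ?addr_ge0 ?sqr_ge0//.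
  by case: (f w).
rewrite (_ : (fun _ => _) = (\- ((fun w => complex.Im (f w)) \* n))%R).
  by apply: measurable_funN; apply: measurable_funM => //; exact: measurable_Im.
apply/funext => w; rewrite /n /= powR_inv1 ?addr_ge0 ?sqr_ge0//.
by case: (f w).
Qed.

Lemma measurable_ceq0 f : measurable_fun setT f ->
  measurable_fun setT (fun w => f w == 0).
Proof.
move=> mf; rewrite (_ : (fun _ => _) = (fun w =>
  (complex.Re (f w) == 0) && (complex.Im (f w) == 0))).
  apply: measurable_and; apply: measurable_fun_eqr => //.
  - exact: measurable_Re.
  - exact: measurable_Im.
by apply/funext => w; case: (f w) => a b; rewrite eq_complex.
Qed.

Section matrices.
Variable n : nat.
Implicit Types A : T -> 'M[C]_n.

Definition measurable_mx m p (A : T -> 'M[C]_(m, p)) :=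
  forall i j, measurable_fun setT (fun w => A w i j).

Lemma measurable_mulmx m p q (A : T -> 'M[C]_(m, p)) (B : T -> 'M[C]_(p, q)) :
  measurable_mx A -> measurable_mx B -> measurable_mx (fun w => A w *m B w).
Proof.
move=> mA mB i j; under eq_fun do rewrite mxE.
by apply: measurable_csum => k; apply: measurable_cmul; [exact: mA|exact: mB].
Qed.

Lemma measurable_det m (A : T -> 'M[C]_m) : measurable_mx A ->
  measurable_fun setT (fun w => \det (A w)).
Proof.
move=> mA; apply: measurable_csum => s; apply: measurable_cmul => //.
by apply: measurable_cprod => i; exact: mA.
Qed.

Lemma measurable_unitmx A : measurable_mx A ->
  measurable_fun setT (fun w => A w \in unitmx).
Proof.
move=> mA; under eq_fun do rewrite unitmxE unitfE.
apply: (@measurableT_comp _ _ _ _ _ _ negb) => //.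
exact/measurable_ceq0/measurable_det.
Qed.

(** Cofactor formula on invertible matrices; on the others [invmx] returns its argument, hence the
    case distinction. *)
Lemma measurable_invmx A : measurable_mx A -> measurable_mx (fun w =>
  invmx (A w)).
Proof.
move=> mA i j; rewrite (_ : (fun _ => _) = (fun w => if A w \in unitmx then
    (\det (A w))^-1 * ((-1) ^+ (j + i) * \det (row' j (col' i (A w)))) else A w
      i j)).
  apply: measurable_fun_ifT.
  - exact: measurable_unitmx.
  - apply: measurable_cmul; first exact/measurable_cinv/measurable_det.
    apply: measurable_cmul => //; apply: measurable_det => a b.
    by under eq_fun do rewrite !mxE; exact: mA.
  - exact: mA.
by apply/funext => w; rewrite /invmx; case: ifP => // _; rewrite !mxE.
Qed.

End matrices.

End measurable_complex_fun.

(** * Independence and product measures *)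

Section independence.
Local Open Scope ereal_scope.
Context (R : realType) (d : measure_display) (T : measurableType d).
Variable P : probability T R.

Lemma probability_integral_indic (A : set T) : measurable A ->
  P A = \int[P]_w (\1_A w)%:E.
Proof. by move=> mA; rewrite integral_indic// setIT. Qed.

Section independent_pair.
Context d1 d2 (S1 : measurableType d1) (S2 : measurableType d2).
Variables (X : T -> S1) (Y : T -> S2).
Hypotheses (mX : measurable_fun setT X) (mY : measurable_fun setT Y).
Hypothesis XY : independent P X Y.

Let rX : {mfun T >-> S1} := HB.pack X (isMeasurableFun.Build _ _ _ _ X mX).
Let rY : {mfun T >-> S2} := HB.pack Y (isMeasurableFun.Build _ _ _ _ Y mY).
Let mXY : measurable_fun setT (fun w => (X w, Y w)) :=
  measurable_fun_pair mX mY.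
Let rXY : {mfun T >-> (S1 * S2)%type} := HB.pack (fun w => (X w, Y w))
  (isMeasurableFun.Build _ _ _ _ (fun w => (X w, Y w)) mXY).

(** Independence identifies the joint law with the product of the marginals on rectangles, hence
    everywhere; Tonelli's theorem then splits the integral. *)
Lemma independent_integral (f : S1 * S2 -> \bar R) :
  measurable_fun setT f -> (forall z, 0 <= f z) ->
  \int[P]_w f (X w, Y w) = \int[P]_w \int[P]_w' f (X w, Y w').
Proof.
move=> mf f0.
have -> : \int[P]_w f (X w, Y w) = \int[distribution P rXY]_z f z.
  by rewrite ge0_integral_distribution.
have -> : \int[distribution P rXY]_z f z =
    \int[distribution P rX \x distribution P rY]_z f z.
  apply/esym/eq_measure_integral => A mA _.
  by apply: product_measure_unique => // B C mB mC; exact: XY.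
rewrite fubini_tonelli1// ge0_integral_distribution//=; last first.
- by move=> x; apply: integral_ge0.
- exact: measurable_fun_fubini_tonelli_F.
apply: eq_integral => w _; rewrite /fubini_F ge0_integral_distribution//.
exact: measurableT_comp.
Qed.

Lemma measurable_independent_integral (f : S1 * S2 -> \bar R) :
  measurable_fun setT f -> (forall z, 0 <= f z) ->
  measurable_fun setT (fun x => \int[P]_w' f (x, Y w')).
Proof.
move=> mf f0; have := @measurable_fun_fubini_tonelli_F _ _ S1 S2 R
  (distribution P rY) f mf f0.
congr measurable_fun; apply/funext => x.
by rewrite /fubini_F ge0_integral_distribution//; exact: measurableT_comp.
Qed.

Variable C : set (S1 * S2).
Hypothesis mC : measurable C.

Let mCXY : measurable [set w | C (X w, Y w)].
Proof. by rewrite -[X in measurable X]setTI; exact: (mXY measurableT mC). Qed.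

Let mCY x : measurable [set w | C (x, Y w)].
Proof.
rewrite -[X in measurable X]setTI.
have m : measurable_fun setT (fun w => (x, Y w)) by apply: measurable_fun_pair.
exact: (m measurableT _ mC).
Qed.

Let mF : measurable_fun setT (fun x => P [set w | C (x, Y w)]).
Proof.
have := @measurable_independent_integral (fun z => (\1_C z)%:E).
rewrite (_ : (fun x => \int[P]_w' (\1_C (x, Y w'))%:E) = (fun x =>
  P [set w | C (x, Y w)])).
  by apply => //; exact/measurable_EFinP.
by apply/funext => x; rewrite probability_integral_indic.
Qed.

Lemma independent_section :
  P [set w | C (X w, Y w)] = \int[P]_w P [set w' | C (X w, Y w')].
Proof.
rewrite probability_integral_indic//.
transitivity (\int[P]_w (\1_C (X w, Y w))%:E); first by [].
rewrite (independent_integral (f := fun z => (\1_C z)%:E)).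
- by apply: eq_integral => w _; rewrite probability_integral_indic.
- exact/measurable_EFinP.
- by move=> z; rewrite lee_fin.
Qed.

(** Freeze the value of [X]: a bound over [Y] alone, uniform in that value, survives the integration
    over [X]. *)
Lemma independent_section_ub (c : \bar R) :
  (forall x, P [set w | C (x, Y w)] <= c) -> P [set w | C (X w, Y w)] <= c.
Proof.
move=> ub; rewrite independent_section.
rewrite -[leRHS]mule1 -(probability_setT P) -integral_cst//.
apply: ge0_le_integral => //.
exact: (measurableT_comp mF mX).
Qed.

(** Same freezing argument, with the integral over [X] restricted to the good values [G]. *)
Lemma independent_section_lb (G : set S1) (c : \bar R) : measurable G ->
  0 <= c ->
  (forall x, G x -> c <= P [set w | C (x, Y w)]) ->
  c * P (X @^-1` G) <= P [set w | C (X w, Y w)].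
Proof.
move=> mG c0 lb; rewrite independent_section.
have mXG : measurable (X @^-1` G) by rewrite -[X in measurable X]setTI;
  exact: mX.
rewrite -integral_cst//.
apply: (@le_trans _ _ (\int[P]_(w in X @^-1` G) P [set w' | C (X w, Y w')])).
  apply: ge0_le_integral => //; last by move=> w /lb.
  by apply: measurable_funTS; exact: (measurableT_comp mF mX).
apply: ge0_subset_integral => //.
exact: (measurableT_comp mF mX).
Qed.

Lemma independent_setI_integral (B : set S1) (f : S2 -> \bar R) (D : set S2) :
  measurable B -> measurable D -> measurable_fun setT f ->
    (forall z, 0 <= f z) ->
  \int[P]_(w in X @^-1` B `&` Y @^-1` D) f (Y w) =
  P (X @^-1` B) * \int[P]_(w in Y @^-1` D) f (Y w).
Proof.
move=> mB mD mf f0.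
have mfD : measurable_fun setT (f \_ D).
  by apply/(measurable_restrictT _ _).1 => //; exact: measurable_funTS.
have fD0 z : 0 <= (f \_ D) z by rewrite erestrict_ge0.
have mXB : measurable (X @^-1` B) by rewrite -[X in measurable X]setTI;
  exact: mX.
rewrite [LHS]integral_mkcond [in RHS]integral_mkcond.
transitivity (\int[P]_w ((\1_B (X w))%:E * (f \_ D) (Y w))).
  apply: eq_integral => w _; rewrite !patchE indicE in_setI.
  rewrite [w \in X @^-1` B](_ : _ = (X w \in B)) 1?[w \in Y @^-1` D](_ : _ =
    (Y w \in D))//.
  by case: (X w \in B); case: (Y w \in D); rewrite ?(mul1e,mul0e,mule0).
rewrite (independent_integral (f := fun z => (\1_B z.1)%:E * (f \_ D) z.2));
  last first.
- by move=> z; rewrite mule_ge0// lee_fin.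
- apply: emeasurable_funM.
    by apply/measurable_EFinP; apply: measurableT_comp => //.
  exact: (measurableT_comp mfD measurable_snd).
transitivity (\int[P]_w ((\int[P]_w' (f \_ D) (Y w')) * (\1_(X @^-1` B) w)%:E)).
  apply: eq_integral => w _ /=; rewrite ge0_integralZl//; last first.
    exact: (measurableT_comp mfD mY).
  by rewrite muleC.
rewrite ge0_integralZl//; last 2 first.
- exact/measurable_EFinP.
- by apply: integral_ge0.
by rewrite -probability_integral_indic// muleC.
Qed.

End independent_pair.

End independence.

(** * Tuples of independent variables: head against tail *)

Section head_behead.
Local Open Scope ereal_scope.
Context (R : realType) (d : measure_display) (T : measurableType d).
Variable P : probability T R.
Context d1 (S : measurableType d1).

Definition tuple_box n (F : 'I_n -> set S) : set (n.-tuple S) :=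
  [set t | forall i, F i (tnth t i)].

Lemma measurable_tuple_box n (F : 'I_n -> set S) :
  (forall i, measurable (F i)) -> measurable (tuple_box F).
Proof.
move=> mF.
have -> : tuple_box F = \bigcap_(i in [set: 'I_n]) ((@tnth _ _ ^~ i) @^-1` F i).
  by apply/seteqP; split=> t /= H i => [_|]; exact: H.
apply: fin_bigcap_measurable => // i _; rewrite -[X in measurable X]setTI.
by apply: measurable_tnth.
Qed.

(** A coordinate cylinder is a box whose other factors are [setT], and a box is a finite
    intersection of cylinders. Boxes are thus a generating pi-system. *)
Lemma measurable_tupleE n : @measurable _ (n.-tuple S) =
  <<s [set B | exists2 F, (forall i : 'I_n, measurable (F i)) & B =
    tuple_box F] >>.
Proof.
apply/seteqP; split; last first.
  apply: smallest_sub; first exact: sigma_algebra_measurable.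
  by move=> _ [F mF ->]; exact: measurable_tuple_box.
apply: smallest_sub; first exact: smallest_sigma_algebra.
elim/big_ind: _ => //.
  by move=> A B HA HB; rewrite subUset.
move=> i _ _ [B mB <-]; rewrite setTI; apply: sub_sigma_algebra.
exists (fun j => if j == i then B else setT); first by move=> j; case: ifP.
apply/seteqP; split=> t /= H.
  by move=> j; case: eqP => // ->.
by have := H i; rewrite eqxx.
Qed.


Lemma setI_closed_tuple_box n :
  setI_closed [set B | exists2 F, (forall i : 'I_n, measurable (F i)) & B =
    tuple_box F].
Proof.
move=> _ _ [F mF ->] [G mG ->]; exists (fun i => F i `&` G i).
  by move=> i; exact: measurableI.
apply/seteqP; split=> t /=; first by case=> HF HG i; split.
by move=> H; split=> i; case: (H i).
Qed.

Lemma measure_tuple_eq n (m1 m2 : {measure set (n.-tuple S) -> \bar R}) :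
  m1 setT < +oo ->
  (forall F : 'I_n -> set S, (forall i, measurable (F i)) ->
     m1 (tuple_box F) = m2 (tuple_box F)) ->
  forall B, measurable B -> m1 B = m2 B.
Proof.
move=> m1T m12 B mB.
have boxT : tuple_box (fun=> setT) = [set: n.-tuple S] by apply/seteqP; split.
apply: (measure_unique _ (fun=> setT) (measurable_tupleE n)
  (@setI_closed_tuple_box n)) => //.
- by move=> _; exists (fun=> setT).
- by apply/seteqP; split=> // t _; exists 0%N.
- by move=> _ [F mF ->]; exact: m12.
Qed.

(** For fixed [A], both sides are finite measures in [B]; by uniqueness it suffices to compare them
    on boxes, where mutual independence factors everything. *)
Lemma independent_head_behead n (v : T -> n.+1.-tuple S) :
  measurable_fun setT v -> mutually_independent P (fun i w => tnth (v w) i) ->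
  independent P (fun w => thead (v w)) (fun w =>
    [tuple of behead (v w)] : n.-tuple S).
Proof.
move=> mv ind A B mA mB.
pose hv w := thead (v w).
pose bv w : n.-tuple S := [tuple of behead (v w)].
have mh : measurable_fun setT hv.
  exact: (measurableT_comp (measurable_tnth ord0) mv).
have mbh := @measurable_behead _ S n.
have mb : measurable_fun setT bv.
  exact: (measurableT_comp mbh mv).
pose U : {mfun T >-> S} := HB.pack hv (isMeasurableFun.Build _ _ _ _ hv mh).
pose V : {mfun T >-> n.-tuple S} :=
  HB.pack bv (isMeasurableFun.Build _ _ _ _ bv mb).
have mXA : measurable (U @^-1` A) by rewrite -[X in measurable X]setTI;
  exact: (mh measurableT _ mA).
have k0 : (0 <= fine (P (U @^-1` A)))%R by rewrite fine_ge0.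
(* The structure is named because unification cannot find [mb]. *)
pose m1 :=
  measure_function_pushforward__canonical__measure_function_Measure
    (mrestr P mXA) mb.
pose m2 := mscale (NngNum k0) (distribution P V).
have finA : (fine (P (U @^-1` A)))%:E = P (U @^-1` A)
  by rewrite fineK// fin_num_measure.
suff E : m1 B = m2 B.
  by move: E; rewrite /m1 /m2 /= /mscale/= finA /distribution /pushforward
    /mrestr setIC.
apply: measure_tuple_eq => //.
  rewrite /m1/= /pushforward /mrestr preimage_setT setTI.
  by rewrite (le_lt_trans (probability_le1 P mXA))// ltry.
move=> F mF; rewrite /m1 /m2 /= /mscale/= finA /distribution /pushforward
  /mrestr setIC.
(* The box with [C] at the head and [F] on the tail. [C := A] gives the joint probability,
   [C := setT] the probability of the tail event alone. *)
pose F' (C : set S) i := if unlift ord0 i is Some j then F j else C.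
have mF' C : measurable C -> forall i, measurable (F' C i).
  by move=> mC i; rewrite /F'; case: unliftP.
have tnthE w i : tnth (v w) (lift ord0 i) = tnth (bv w) i.
  by rewrite [in LHS](tuple_eta (v w)) tnthS.
have F'E C : [set w | forall i, i \in [set: 'I_n.+1]%SET ->
  F' C i (tnth (v w) i)] =
    hv @^-1` C `&` bv @^-1` tuple_box F.
  apply/seteqP; split=> w /=.
    move=> H; split; first by have := H ord0; rewrite /F' unlift_none; apply;
      rewrite inE.
    by move=> i; rewrite -tnthE; have := H (lift ord0 i); rewrite /F' liftK;
      apply; rewrite inE.
  move=> [HC HF] i _; rewrite /F'; case: unliftP => [j ->|->//].
  by rewrite tnthE.
have := ind [set: 'I_n.+1]%SET _ (mF' _ mA); rewrite F'E => E1.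
have := ind [set: 'I_n.+1]%SET _ (mF' _ measurableT);
  rewrite F'E preimage_setT setTI => E2.
have prodE (G : 'I_n.+1 -> \bar R) :
    \prod_(i in [set: 'I_n.+1]%SET) G i = G ord0 * \prod_(i < n) G (lift ord0
      i).
  by rewrite (eq_bigl xpredT) ?big_ord_recl// => i; rewrite inE.
rewrite E1 E2 !prodE /F' unlift_none preimage_setT probability_setT mul1e.
by congr (_ * _); apply: eq_bigr => i _; rewrite liftK.
Qed.

End head_behead.

(** * Conditional probabilities given an independent variable *)

Section conditional_probability.
Local Open Scope ereal_scope.
Context (R : realType) (d : measure_display) (T : measurableType d).
Variable P : probability T R.
Context d1 d2 (S1 : measurableType d1) (S2 : measurableType d2).
Variables (Z : {mfun T >-> S1}) (X : {mfun T >-> S2}).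
Hypothesis ZX : independent P Z X.
Variables (A : set T) (B : set S1).
Hypotheses (mA : measurable A) (mB : measurable B).
Let E := Z @^-1` B.
Hypothesis PE : 0 < P E.

Let mE : measurable E.
Proof. by rewrite -[X in measurable X]setTI;
  exact: (@measurable_funPT _ _ _ _ Z measurableT _ mB). Qed.

Let finE : (fine (P E))%:E = P E.
Proof. by rewrite fineK// fin_num_measure. Qed.

Let fE0 : (0 < fine (P E))%R.
Proof. by rewrite -lte_fin finE. Qed.

Let mAE : measurable (A `&` E) := measurableI _ _ mA mE.

Let nu : set S2 -> \bar R := fun C => P (A `&` (E `&` X @^-1` C)).

Let nuE C : nu C = mrestr P mAE (X @^-1` C).
Proof. by rewrite /nu /mrestr setIA setIC. Qed.

Let nu0 : nu set0 = 0.
Proof. by rewrite nuE preimage_set0 measure0. Qed.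

Let nu_ge0 C : 0 <= nu C.
Proof. by rewrite measure_ge0. Qed.

Let nu_sigma_additive : semi_sigma_additive nu.
Proof.
have := @measure_semi_sigma_additive _ _ _
  (measure_function_pushforward__canonical__measure_function_Measure
     (mrestr P mAE) (@measurable_funPT _ _ _ _ X)).
by congr semi_sigma_additive; apply/funext => C /=; rewrite nuE.
Qed.

HB.instance Definition _ := isMeasure.Build _ _ _ nu nu0 nu_ge0
  nu_sigma_additive.

Let nu_fin : fin_num_fun nu.
Proof.
move=> C mC; rewrite nuE fin_num_measure// -[X in measurable X]setTI.
exact: (@measurable_funPT _ _ _ _ X measurableT _ mC).
Qed.

HB.instance Definition _ := Measure_isFinite.Build _ _ _ nu nu_fin.

(* The version is the density of [nu] with respect to the law of [X], divided by
   [P E]. *)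
Lemma is_cond_prob_exists : exists f, is_cond_prob P A E X f.
Proof.
have nu_dom : nu `<< distribution P X.
  apply/null_content_dominatesP => C mC;
    rewrite /distribution /pushforward => PC0.
  have mXC : measurable (X @^-1` C) by rewrite -[W in measurable W]setTI;
    exact: (@measurable_funPT _ _ _ _ X measurableT _ mC).
  apply/eqP; rewrite eq_le measure_ge0 andbT -PC0 nuE /mrestr.
  by rewrite le_measure ?inE//; exact: measurableI.
have [g [g0 gfin gint gE]] := radon_nikodym_sigma_finite nu_dom.
have mg := measurable_int _ gint.
have mX : measurable_fun setT X by exact: measurable_funPT.
exists (fun s => (fine (P E))^-1 * fine (g s))%R; split.
- by apply: measurable_funM => //; exact: measurableT_comp.
- by move=> u; rewrite mulr_ge0 ?invr_ge0 ?fine_ge0// ltW.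
move=> C mC.
have mXC : measurable (X @^-1` C) by rewrite -[W in measurable W]setTI;
  exact: mX.
(* Independence of [E] and [X] pulls [P E] out of the integral, where it cancels the division by
   [P E] in the version. *)
rewrite (independent_setI_integral _ _ ZX (f :=
  fun s => ((fine (P E))^-1 * fine (g s))%:E))//; last 2 first.
- by apply/measurable_EFinP; apply: measurable_funM => //;
  exact: measurableT_comp.
- by move=> z; rewrite lee_fin mulr_ge0 ?invr_ge0 ?fine_ge0// ltW.
transitivity (P E * ((fine (P E))^-1%:E * \int[P]_(w in X @^-1` C) g (X w))).
  congr (_ * _); rewrite -ge0_integralZl//; last 2 first.
  - by apply: measurable_funTS; exact: measurableT_comp.
  - by rewrite lee_fin invr_ge0 ltW.
  by apply: eq_integral => w _; rewrite EFinM fineK.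
rewrite muleA -{1}finE -EFinM mulfV ?gt_eqF// mul1e.
transitivity (\int[distribution P X]_(x in C) g x).
  by rewrite /distribution ge0_integral_pushforward//; exact: measurable_funTS.
by rewrite -gE.
Qed.

(** The defining identity over the whole space, from which independence of [Z] and [X] factors out
    [P E]. As a version exists, [xget] does not fall back on its default. *)
Lemma expectation_cond_prob :
  'E_P[fun w => cond_prob P A E X (X w)] * P E = P (A `&` E).
Proof.
have [f0 Hf0] := is_cond_prob_exists.
have : is_cond_prob P A E X (cond_prob P A E X) by apply: (xgetPex (cst 0%R));
  exists f0.
set f := cond_prob _ _ _ _ => -[mf fp /(_ setT measurableT)].
rewrite preimage_setT setIT => <-; rewrite unlock muleC.
rewrite -{2}(setIT E) -(preimage_setT X).
by rewrite (independent_setI_integral _ _ ZX (f :=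
  fun s => (f s)%:E))// ?preimage_setT//; exact/measurable_EFinP.
Qed.

End conditional_probability.

(** * Gaussian estimates *)

Section gaussian.
Context (R : realType).
Local Notation C := R[i].
Import Normc.

Definition cn_sd : R := Num.sqrt 2^-1.
Local Notation N := (normal_prob (0 : R) cn_sd).
Local Notation mu := (@lebesgue_measure R).

Lemma cn_sd_neq0 : cn_sd != 0.
Proof. by rewrite /cn_sd gt_eqF// sqrtr_gt0 invr_gt0. Qed.

(** Variance [1/2] makes the denominator [2 sigma^2] of the exponent equal to [1]. *)
Lemma normal_pdf_cn_sd x : normal_pdf 0 cn_sd x =
  normal_peak cn_sd * expR (- x ^+ 2).
Proof.
rewrite normal_pdfE ?cn_sd_neq0// /normal_fun /cn_sd sqr_sqrtr ?invr_ge0//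
  subr0.
by rewrite -(mulr_natr 2^-1) mulVf// divr1.
Qed.

Lemma normal_prob_ub (a b : R) : a <= b ->
  (N `[a, b]%classic <= (normal_peak cn_sd * (b - a))%:E)%E.
Proof.
move=> ab; rewrite /normal_prob.
apply: (@le_trans _ _ (\int[mu]_(x in `[a, b]%classic) (normal_peak
  cn_sd)%:E)%E).
  apply: ge0_le_integral => //.
  - by move=> x _; rewrite lee_fin normal_pdf_ge0.
  - by apply/measurable_EFinP/measurable_funTS; exact: measurable_normal_pdf.
  - by move=> x _; rewrite lee_fin normal_pdf_ub// cn_sd_neq0.
rewrite integral_cst//= lebesgue_measure_itv/= lte_fin.
case: ltP => [_|ba]; first by rewrite -EFinD -EFinM.
by rewrite mule0 lee_fin mulr_ge0 ?normal_peak_ge0// subr_ge0.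
Qed.

(* Minimum over [-m, m] of the N(0, 1/2) density. *)
Definition pdf_low (m : R) : R := normal_peak cn_sd * expR (- m ^+ 2).

Lemma pdf_low_gt0 m : 0 < pdf_low m.
Proof. by rewrite mulr_gt0 ?expR_gt0// normal_peak_gt0// cn_sd_neq0. Qed.

Lemma normal_prob_lb (m a b : R) : - m <= a -> a <= b -> b <= m ->
  ((pdf_low m * (b - a))%:E <= N `[a, b]%classic)%E.
Proof.
move=> ma ab bm; rewrite /normal_prob.
apply: (@le_trans _ _ (\int[mu]_(x in `[a, b]%classic) (pdf_low m)%:E)%E).
  rewrite integral_cst//= lebesgue_measure_itv/= lte_fin.
  case: ltP => [_|ba]; first by rewrite -EFinD -EFinM.
  by rewrite mule0 lee_fin pmulr_rle0 ?pdf_low_gt0// subr_le0.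
apply: ge0_le_integral => //.
- by move=> x _; rewrite lee_fin ltW// pdf_low_gt0.
- by apply/measurable_EFinP/measurable_funTS; exact: measurable_normal_pdf.
move=> x /=; rewrite in_itv/= => /andP[ax xb].
rewrite lee_fin normal_pdf_cn_sd ler_wpM2l ?normal_peak_ge0// ler_expR lerN2.
have xm : `|x| <= m by rewrite ler_norml (le_trans ma ax) (le_trans xb bm).
by rewrite -(real_normK (num_real x)) lerXn2r ?nnegrE// (le_trans _ xm).
Qed.

(* For [a < |x|], [exp (- x^2) <= exp (- a^2/2) * exp (- x^2/2)], and the last
   factor is a multiple of the N(0, 1) density. *)
Lemma normal_prob_tail : exists2 K : R, 0 < K & forall a, 0 <= a ->
  (N [set x | a < `|x|]%R <= (K * expR (- (a ^+ 2 / 2)))%:E)%E.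
Proof.
have pk1 : 0 < normal_peak (1 : R) by rewrite normal_peak_gt0// oner_eq0.
exists (normal_peak cn_sd / normal_peak 1);
  first by rewrite divr_gt0// normal_peak_gt0// cn_sd_neq0.
move=> a a0; rewrite /normal_prob; set K := _ * _.
have K0 : 0 <= K by rewrite mulr_ge0 ?expR_ge0// divr_ge0 ?normal_peak_ge0.
have mA : measurable [set x : R | a < `|x|].
  have mlt : measurable_fun setT (fun x : R => a < `|x|)
    by apply: measurable_fun_ltr.
  by rewrite -[X in measurable X]setTI; exact: (mlt measurableT [set true]).
apply: (@le_trans _ _ (\int[mu]_(x in [set x | a < `|x|]%R) (K * normal_pdf 0 1
  x)%:E)%E).
  apply: ge0_le_integral => //.
  - by move=> x _; rewrite lee_fin normal_pdf_ge0.
  - by apply/measurable_EFinP/measurable_funTS; exact: measurable_normal_pdf.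
  - apply/measurable_EFinP/measurable_funTS; apply: measurable_funM => //.
    exact: measurable_normal_pdf.
  move=> x /= ax; rewrite lee_fin normal_pdf_cn_sd normal_pdfE ?oner_eq0//
    /normal_fun /K.
  rewrite subr0 expr1n mulrACA divfK ?gt_eqF//.
  rewrite ler_wpM2l ?normal_peak_ge0// -expRD ler_expR.
  have : a ^+ 2 <= x ^+ 2.
    by rewrite -(real_normK (num_real x)) lerXn2r ?nnegrE// ltW.
  by lra.
apply: (@le_trans _ _ (\int[mu]_x (K * normal_pdf 0 1 x)%:E)%E).
  apply: ge0_subset_integral => //.
  - apply/measurable_EFinP; apply: measurable_funM => //.
    exact: measurable_normal_pdf.
  - by move=> x _; rewrite lee_fin mulr_ge0 ?normal_pdf_ge0.
under eq_integral do rewrite EFinM.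
rewrite ge0_integralZl_EFin//.
- by rewrite integral_normal_pdf mule1.
- by move=> x _; rewrite lee_fin normal_pdf_ge0.
- by apply/measurable_EFinP; exact: measurable_normal_pdf.
Qed.

Definition cbox (I J : set R) : set C :=
  [set z | I (complex.Re z) /\ J (complex.Im z)].

Lemma measurable_cbox I J : measurable I -> measurable J ->
  measurable (cbox I J).
Proof.
move=> mI mJ; exists (I `*` J); first exact: measurableX.
by rewrite setTI; apply/seteqP; split.
Qed.

Lemma CN01_cbox I J : measurable I -> measurable J ->
  CN01 (cbox I J) = (N I * N J)%E.
Proof.
move=> mI mJ; rewrite /CN01 /pushforward -product_measure1E//.
Qed.

Lemma normc_le (z : C) : normc z <= `|complex.Re z| + `|complex.Im z|.
Proof.
case: z => a b /=; rewrite -[leRHS]ger0_norm ?addr_ge0// -sqrtr_sqr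
  ler_wsqrtr//.
rewrite sqrrD !real_normK ?num_real// lerD2r lerDl mulrn_wge0// mulr_ge0//.
Qed.

Lemma Re_le_normc (z : C) : `|complex.Re z| <= normc z.
Proof. by case: z => a b /=; rewrite -sqrtr_sqr ler_wsqrtr// lerDl sqr_ge0. Qed.

Lemma Im_le_normc (z : C) : `|complex.Im z| <= normc z.
Proof. by case: z => a b /=; rewrite -sqrtr_sqr ler_wsqrtr// lerDr sqr_ge0. Qed.

End gaussian.

(** * Boxes and discs for vectors of independent complex Gaussians *)

Section iid_gaussian.
Context (R : realType) (d : measure_display) (T : measurableType d).
Variable P : probability T R.
Local Notation C := R[i].
Import Normc.
Local Notation N := (normal_prob (0 : R) (cn_sd R)).

Definition box_vec m (I J : 'I_m -> set R) : set (m.-tuple C) :=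
  tuple_box (fun i => cbox (I i) (J i)).

Lemma measurable_box_vec m (I J : 'I_m -> set R) :
  (forall i, measurable (I i)) -> (forall i, measurable (J i)) ->
  measurable (box_vec I J).
Proof.
by move=> mI mJ; apply: measurable_tuple_box => i; exact: measurable_cbox.
Qed.

Section vec.
Variables (m : nat) (v : T -> m.-tuple C).
Hypothesis mv : measurable_fun setT v.
Hypothesis iv : iid_CN01 P v.

Lemma measurable_iid_tnth i : measurable_fun setT (fun w => tnth (v w) i).
Proof. exact: (measurableT_comp (measurable_tnth i) mv). Qed.

Lemma iid_box i (I J : set R) : measurable I -> measurable J ->
  P [set w | cbox I J (tnth (v w) i)] = (N I * N J)%E.
Proof.
by move=> mI mJ; rewrite iv.2 ?CN01_cbox//; exact: measurable_cbox.
Qed.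

Lemma iid_box_vec (I J : 'I_m -> set R) (c : R) : 0 <= c ->
  (forall i, measurable (I i)) -> (forall i, measurable (J i)) ->
  (forall i, (c%:E <= N (I i))%E) -> (forall i, (c%:E <= N (J i))%E) ->
  (((c * c) ^+ m)%:E <= P [set w | box_vec I J (v w)])%E.
Proof.
move=> c0 mI mJ cI cJ.
have mB i : measurable (cbox (I i) (J i)) by exact: measurable_cbox.
have := iv.1 [set: 'I_m]%SET _ mB.
rewrite (_ : [set w | _] = [set w | box_vec I J (v w)]); last first.
  apply/seteqP; split=> w /= H i; first by apply: H; rewrite inE.
  by move=> _; exact: H.
move=> ->; rewrite (eq_bigl xpredT); last by move=> i; rewrite inE.
have -> : (c * c) ^+ m = \prod_(i < m) (c * c) by rewrite prodr_const card_ord.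
rewrite -prodEFin.
(* Nonnegativity is carried along the induction, as it is needed to multiply inequalities. *)
have : (0%:E <= \prod_(i < m) (c * c)%:E)%E /\
   (\prod_(i < m) (c * c)%:E <= \prod_(i < m) P ((fun w =>
     tnth (v w) i) @^-1` cbox (I i) (J i)))%E.
  elim/big_ind2 : _ => //.
    move=> x1 x2 y1 y2 [a0 ab] [b0 bb]; split; first by rewrite mule_ge0.
    by rewrite lee_pmul.
  move=> i _; split; first by rewrite lee_fin mulr_ge0.
  rewrite [leRHS](iid_box i (mI i) (mJ i)) EFinM lee_pmul ?lee_fin//.
by case.
Qed.

(** The disc lies in a square of side [2 r], and the density is at most its peak. The bound does not
    depend on the centre [- z]. *)
Lemma iid_ball_ub i (z : C) (r : R) : 0 < r ->
  (P [set w | (normc (tnth (v w) i + z) < r)%R] <=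
   ((normal_peak (cn_sd R) * (r *+ 2)) ^+ 2)%:E)%E.
Proof.
move=> r0; pose I a : set R := `[- a - r, - a + r]%classic.
have mI a : measurable (I a) by exact: measurable_itv.
have NI a : (N (I a) <= (normal_peak (cn_sd R) * (r *+ 2))%:E)%E.
  apply: (le_trans (normal_prob_ub _)); first by lra.
  by rewrite lee_fin ler_wpM2l ?normal_peak_ge0//; lra.
apply: (@le_trans _ _ (P [set w | cbox (I (complex.Re z)) (I (complex.Im z))
  (tnth (v w) i)])).
  rewrite le_measure ?inE//.
  - rewrite -[X in measurable X]setTI.
    have mf : measurable_fun setT (fun w => (normc (tnth (v w) i + z) < r)%R).
      apply: measurable_fun_ltr => //; apply: measurable_normc.
      by apply: measurable_cadd; [exact: measurable_iid_tnth|exact: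
        measurable_cst].
    exact: (mf measurableT [set true]).
  - rewrite -[X in measurable X]setTI;
    apply: (measurable_iid_tnth i measurableT).
    exact: measurable_cbox (mI _) (mI _).
  move=> w /=; move: (tnth (v w) i) => y nr.
  have := le_lt_trans (Re_le_normc _) nr;
    have := le_lt_trans (Im_le_normc _) nr.
  rewrite !ltr_norml; case: y z nr => [a b] [a' b'] /= _ /andP[h1 h2] /andP[h3
    h4].
  by rewrite /cbox /I /= !in_itv/=; split; apply/andP; split; lra.
by rewrite iid_box// expr2 EFinM lee_pmul ?NI.
Qed.

(** The disc contains the concentric square of side [r / 2], whose coordinates stay within [m0 + 1],
    where the density is at least [pdf_low (m0 + 1)]. *)
Lemma iid_ball_lb i (z : C) (r m0 : R) : 0 < r -> r <= 1 ->
  `|complex.Re z| <= m0 -> `|complex.Im z| <= m0 ->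
  (((pdf_low (m0 + 1) * (r / 2)) ^+ 2)%:E <=
   P [set w | (normc (tnth (v w) i + z) < r)%R])%E.
Proof.
move=> r0 r1 zR zI; pose I a : set R := `[- a - r / 4, - a + r / 4]%classic.
have mI a : measurable (I a) by exact: measurable_itv.
have NI a : `|a| <= m0 -> ((pdf_low (m0 + 1) * (r / 2))%:E <= N (I a))%E.
  rewrite ler_norml => /andP[h1 h2].
  apply: le_trans (normal_prob_lb (m := m0 + 1) _ _ _); [|lra|lra|lra].
  by rewrite lee_fin ler_pM2l ?pdf_low_gt0//; lra.
have p0 : 0 <= pdf_low (m0 + 1) * (r / 2)
  by rewrite mulr_ge0 ?ltW ?pdf_low_gt0// divr_gt0.
apply: (@le_trans _ _ (P [set w | cbox (I (complex.Re z)) (I (complex.Im z))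
  (tnth (v w) i)])).
  by rewrite iid_box// expr2 EFinM lee_pmul ?NI ?lee_fin.
rewrite le_measure ?inE//.
- rewrite -[X in measurable X]setTI; apply: (measurable_iid_tnth i measurableT).
  exact: measurable_cbox (mI _) (mI _).
- rewrite -[X in measurable X]setTI.
  have mf : measurable_fun setT (fun w => (normc (tnth (v w) i + z) < r)%R).
    apply: measurable_fun_ltr => //; apply: measurable_normc.
    by apply: measurable_cadd; [exact: measurable_iid_tnth|exact:
      measurable_cst].
  exact: (mf measurableT [set true]).
move=> w /=; move: (tnth (v w) i) => y; rewrite /cbox /I /= !in_itv/= => -[].
move=> /andP[h1 h2] /andP[h3 h4].
apply: (le_lt_trans (normc_le _)); rewrite (_ : r = r / 2 + r / 2); last by lra.
case: y z {zR zI} h1 h2 h3 h4 => [a b] [a' b'] /= h1 h2 h3 h4.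
by apply: ltrD; rewrite ltr_norml; apply/andP; split; lra.
Qed.

End vec.

End iid_gaussian.

(** * Small-ball estimates for the channel spectrum *)

Section spectrum_small_ball.
Context (R : realType) (d : measure_display) (T : measurableType d).
Variable P : probability T R.
Local Notation C := R[i].
Import Normc.

Lemma independentC d1 d2 (S1 : measurableType d1) (S2 : measurableType d2)
    (X : T -> S1) (Y : T -> S2) : independent P X Y -> independent P Y X.
Proof. by move=> XY A B mA mB; rewrite setIC muleC XY. Qed.

Lemma measurable_normc_lt d1 (S : measurableType d1) (f : S -> C) r :
  measurable_fun setT f -> measurable [set w | (normc (f w) < r)%R].
Proof.
move=> mf.
have mn : measurable_fun setT (fun w => (normc (f w) < r)%R).
  by apply: measurable_fun_ltr => //; exact: measurable_normc.
by rewrite -[X in measurable X]setTI; exact: (mn measurableT [set true]).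
Qed.

Variables (nu : nat) (h : T -> nu.+1.-tuple C).
Hypothesis mh : measurable_fun setT h.
Hypothesis ih : iid_CN01 P h.

Let beh (t : nu.+1.-tuple C) : nu.-tuple C := [tuple of behead t].
Let rest (w : C) (t : nu.-tuple C) := \sum_(m < nu) tnth t m * w ^+ m.+1.

Let spectrumE (t : nu.+1.-tuple C) w : spectrum t w = thead t + rest w (beh t).
Proof.
rewrite /spectrum big_ord_recl expr0 mulr1; congr (_ + _).
by apply: eq_bigr => m _; rewrite /beh [in LHS](tuple_eta t) tnthS.
Qed.

Lemma measurable_spectrum w : measurable_fun setT (fun x => spectrum (h x) w).
Proof.
apply: measurable_csum => m; apply: measurable_cmul; last exact: measurable_cst.
exact: measurable_iid_tnth.
Qed.

Let mrest w : measurable_fun setT (rest w).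
Proof.
apply: measurable_csum => m; apply: measurable_cmul; last exact: measurable_cst.
exact: measurable_tnth.
Qed.

Let hd x := thead (h x).
Let tl x := beh (h x).

Let mhd : measurable_fun setT hd.
Proof. exact: (measurableT_comp (measurable_tnth ord0) mh). Qed.

Let mtl : measurable_fun setT tl.
Proof. exact: (measurableT_comp (@measurable_behead _ C nu) mh). Qed.

Let ind : independent P tl hd.
Proof. exact: independentC (independent_head_behead mh ih.1). Qed.

Let ball w r : set (nu.-tuple C * C) := [set z | normc (z.2 + rest w z.1) < r].

Let mball w r : measurable (ball w r).
Proof.
apply: measurable_normc_lt; apply: measurable_cadd; first exact: measurable_snd.
exact: (measurableT_comp (mrest w) measurable_fst).
Qed.

Let spectrum_ballE w r : [set x | normc (spectrum (h x) w) < r] =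
  [set x | ball w r (tl x, hd x)].
Proof. by apply/funext => x; rewrite /ball /= spectrumE. Qed.

(** Given the taps other than [h_0], the event puts [h_0] in a disc of radius [r], whose probability
    is bounded uniformly in the centre. *)
Lemma spectrum_ball_ub w (r : R) : 0 < r ->
  (P [set x | (normc (spectrum (h x) w) < r)%R] <=
   ((normal_peak (cn_sd R) * (r *+ 2)) ^+ 2)%:E)%E.
Proof.
move=> r0; rewrite spectrum_ballE;
  apply: (independent_section_ub mtl mhd ind) => // y.
exact: (iid_ball_ub mh ih ord0 (rest w y) r0).
Qed.

(** With positive probability the taps other than [h_0] have coordinates in [[-1, 1]], so both
    coordinates of their sum are at most [nu] in absolute value; [h_0] then has to hit a disc with
    bounded centre. *)
Lemma spectrum1_ball_lb : exists2 c : R, 0 < c & forall r, 0 < r -> r <= 1 ->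
  ((c * r ^+ 2)%:E <= P [set x | (normc (spectrum (h x) 1) < r)%R])%E.
Proof.
pose I : set R := `[-1, 1]%classic.
have mI : measurable I by exact: measurable_itv.
pose G : set (nu.-tuple C) := box_vec (fun=> I) (fun=> I).
have mG : measurable G by exact: measurable_box_vec.
pose q := pdf_low (1 : R) * (1 - (-1)).
have q0 : 0 < q by rewrite mulr_gt0 ?pdf_low_gt0//; lra.
have NI : (q%:E <= normal_prob 0 (cn_sd R) I)%E by apply: normal_prob_lb; lra.
(* Constraining [h_0] to the box as well only lowers the probability, and lets the estimate for the
   full vector apply. *)
have PG : (((q * q) ^+ nu.+1)%:E <= P (tl @^-1` G))%E.
  apply: (le_trans (@iid_box_vec _ _ _ P _ h ih (fun=> I) (fun=> I) q _ _ _ _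
    _)) => //; first exact: ltW.
  rewrite le_measure ?inE//.
  - by rewrite -[X in measurable X]setTI; apply: (mh measurableT);
    exact: measurable_box_vec.
  - by rewrite -[X in measurable X]setTI; apply: (mtl measurableT).
  move=> x /= H i.
  have E : tnth (h x) (lift ord0 i) = tnth (tl x) i.
    by rewrite [in LHS](tuple_eta (h x)) tnthS.
  by rewrite -E; exact: H.
pose p := pdf_low (nu%:R + 1 : R).
have p0 : 0 < p by exact: pdf_low_gt0.
exists ((p / 2) ^+ 2 * (q * q) ^+ nu.+1).
  by apply: mulr_gt0; apply: exprn_gt0; [exact: divr_gt0|exact: mulr_gt0].
move=> r r0 r1; rewrite spectrum_ballE.
have pr0 : 0 <= (p * (r / 2)) ^+ 2 by rewrite sqr_ge0.
apply: (@le_trans _ _ (((p * (r / 2)) ^+ 2)%:E * P (tl @^-1` G))%E); last first.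
  apply: (independent_section_lb mtl mhd ind) => //.
  move=> y Gy; apply: (iid_ball_lb mh ih ord0 (z := rest 1 y)) => //.
  - rewrite /rest raddf_sum/=.
    apply: (le_trans (ler_norm_sum _ _ _)).
    rewrite (_ : nu%:R = \sum_(m < nu) 1); last by rewrite sumr_const card_ord.
    apply: ler_sum => m _; rewrite expr1n mulr1.
    by have [+ _] := Gy m; rewrite /I /= in_itv/= ler_norml.
  - rewrite /rest raddf_sum/=.
    apply: (le_trans (ler_norm_sum _ _ _)).
    rewrite (_ : nu%:R = \sum_(m < nu) 1); last by rewrite sumr_const card_ord.
    apply: ler_sum => m _; rewrite expr1n mulr1.
    by have [_ +] := Gy m; rewrite /I /= in_itv/= ler_norml.
apply: (@le_trans _ _ (((p * (r / 2)) ^+ 2)%:E * ((q * q) ^+ nu.+1)%:E)%E);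
  last first.
  by rewrite lee_wpmul2l// lee_fin.
by rewrite -EFinM lee_fin le_eqVlt; apply/orP; left; apply/eqP; field.
Qed.

End spectrum_small_ball.

(** * The zero-forcing receiver *)

Section zf.
Context (R : realType) (nu L : nat).
Hypothesis nuL : (nu < L)%N.
Local Notation C := R[i].
Import Normc.
Implicit Types (snr : R) (h : nu.+1.-tuple C) (x n : L.-tuple C).

Definition noise h n (l : 'I_L) : C :=
  (invmx (Heq L h) *m \col_i tnth n i) (rev_ord l) 0.

Lemma zf_symbolE snr h x n l : Heq L h \in unitmx ->
  zf_symbol snr h x n l = (Num.sqrt snr)%:C * tnth x l + noise h n l.
Proof.
move=> uH; rewrite /zf_symbol /zf_output /received mulmxDr -scalemxAr mulKmx//.
by rewrite !mxE rev_ordK /noise !mxE.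
Qed.

(** The error event on the values [((h, x), n)], grouped so as to match the independence of the
    noise from the pair of channel and input. *)
Definition errset snr (a b : C) l : set ((nu.+1.-tuple C * L.-tuple C) *
  L.-tuple C) :=
  [set z | let y := zf_symbol snr z.1.1 z.1.2 z.2 l in
     `|y - (Num.sqrt snr)%:C * b| < `|y - (Num.sqrt snr)%:C * a| ].

Lemma errsetE snr (a b : C) l h x n : Heq L h \in unitmx -> tnth x l = a ->
  errset snr a b l ((h, x), n) <->
  normc (noise h n l + (Num.sqrt snr)%:C * (a - b)) < normc (noise h n l).
Proof.
move=> uH xa; rewrite /errset /= zf_symbolE// xa !normCE ltcR.
rewrite (_ : _ - _ * b = noise h n l + (Num.sqrt snr)%:C * (a - b));
  last by ring.
by rewrite (addrC _ (noise _ _ _)) addrK.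
Qed.

(** Triangle inequality: with [u] the noise and [t] the scaled difference of symbols,
    [|t| <= |u + t| + |u| < 2 |u|]. *)
Lemma errset_noise snr (a b : C) l h x n : 0 <= snr -> Heq L h \in unitmx ->
  tnth x l = a ->
  errset snr a b l ((h, x), n) ->
  Num.sqrt snr * normc (a - b) < 2 * normc (noise h n l).
Proof.
move=> s0 uH xa /(errsetE _ _ _ uH xa) E.
have -> : Num.sqrt snr * normc (a - b) = normc ((Num.sqrt snr)%:C * (a - b)).
  rewrite normcM; congr (_ * _).
  by rewrite /= expr0n addr0 sqrtr_sqr ger0_norm// sqrtr_ge0.
set u := noise h n l in E *; set t := _%:C * _ in E *.
have -> : t = (u + t) + - u by ring.
apply: (le_lt_trans (le_normcD _ _)); rewrite normcN; lra.
Qed.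

(** With [u] the noise and [t] the square root of [snr], [|u + t (a - b)|^2 - |u|^2] is
    [2 t Re (u conj(a - b)) + t^2 |a - b|^2], negative by hypothesis. The condition is linear in the
    noise, so it can be forced coordinate by coordinate. *)
Lemma errset_sign snr (a b : C) l h x n : 0 < snr -> Heq L h \in unitmx ->
  tnth x l = a ->
  complex.Re (noise h n l * conjc (a - b)) < - (Num.sqrt snr * normc (a - b) ^+
    2 / 2) ->
  errset snr a b l ((h, x), n).
Proof.
move=> s0 uH xa H; apply/errsetE => //.
have t0 : 0 < Num.sqrt snr by rewrite sqrtr_gt0.
move: t0 H; set u := noise h n l; set t := Num.sqrt snr.
case: (a - b) u => [c e] [p q] /= t0.
rewrite sqr_sqrtr ?addr_ge0 ?sqr_ge0// => H.
rewrite !mul0r subr0 addr0 ltr_sqrt; last first.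
  (* Comparing square roots strictly requires [u != 0]; a zero noise would contradict [H]. *)
  have : p ^+ 2 + q ^+ 2 != 0.
    apply: contraTneq H => /eqP; rewrite paddr_eq0 ?sqr_ge0// !sqrf_eq0 =>
      /andP[/eqP -> /eqP ->].
    by rewrite !mul0r subr0 -leNgt oppr_le0 divr_ge0// mulr_ge0 ?(ltW t0)//
      addr_ge0 ?sqr_ge0.
  by rewrite lt0r addr_ge0 ?sqr_ge0// andbT.
have : 0 < - (t * (2 * (p * c - q * - e) + t * (c ^+ 2 + e ^+ 2))).
  by rewrite -mulrN mulr_gt0//; lra.
by nra.
Qed.

End zf.

(** * Measurability of the receiver output and of the error event *)

Section zf_measurable.
Context (R : realType) (nu L : nat).
Local Notation C := R[i].
Import Normc.
Context d (S : measurableType d).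
Variables (h : S -> nu.+1.-tuple C) (x n : S -> L.-tuple C).
Hypotheses (mh : measurable_fun setT h) (mx : measurable_fun setT x)
  (mn : measurable_fun setT n).

Let mtnth m (f : S -> m.-tuple C) i : measurable_fun setT f ->
  measurable_fun setT (fun w => tnth (f w) i).
Proof. by move=> mf; exact: (measurableT_comp (measurable_tnth i) mf). Qed.

Lemma measurable_Heq : measurable_mx (fun w => Heq L (h w)).
Proof.
move=> i j; under eq_fun do rewrite mxE.
set k := (_ %% _)%N; have [knu|knu] := ltnP k nu.+1.
  rewrite (_ : (fun _ => _) = (fun w => tnth (h w) (Ordinal knu)));
    first exact: mtnth.
  by apply/funext => w; rewrite (tnth_nth 0).
rewrite (_ : (fun _ => _) = cst 0); first exact: measurable_cst.
by apply/funext => w; rewrite nth_default// size_tuple.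
Qed.

Lemma measurable_zf_symbol snr l :
  measurable_fun setT (fun w => zf_symbol snr (h w) (x w) (n w) l).
Proof.
apply: measurable_mulmx; first exact/measurable_invmx/measurable_Heq.
move=> i j; under eq_fun do rewrite !mxE.
apply: measurable_cadd; last exact: mtnth.
apply: measurable_cmul; first exact: measurable_cst.
apply: measurable_csum => k; apply: measurable_cmul; last first.
  by under eq_fun do rewrite mxE; exact: mtnth.
exact: measurable_Heq.
Qed.

Lemma measurable_error snr (a b : C) l : measurable
  [set w | let y := zf_symbol snr (h w) (x w) (n w) l in
     `|y - (Num.sqrt snr)%:C * b| < `|y - (Num.sqrt snr)%:C * a| ].
Proof.
have mf c : measurable_fun setT (fun w => normc (zf_symbol snr (h w) (x w) (n
  w) l - (Num.sqrt snr)%:C * c)).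
  apply: measurable_normc; apply: measurable_cadd; last exact: measurable_cst.
  exact: measurable_zf_symbol.
have mb := measurable_fun_ltr (mf b) (mf a).
rewrite [X in measurable X](_ : _ = (fun w =>
  normc (zf_symbol snr (h w) (x w) (n w) l - (Num.sqrt snr)%:C * b) < normc
  (zf_symbol snr (h w) (x w) (n w) l - (Num.sqrt snr)%:C * a)) @^-1` [set
  true]).
  by rewrite -[X in measurable X]setTI; exact: (mb measurableT).
by apply/seteqP; split=> w /=; rewrite !normCE ltcR.
Qed.

Lemma measurable_complex_eq (f : S -> C) c : measurable_fun setT f ->
  measurable [set w | f w = c].
Proof.
move=> mf; have m0 : measurable_fun setT (fun w => f w - c == 0).
  by apply: measurable_ceq0; apply: measurable_cadd => //;
    exact: measurable_cst.
rewrite [X in measurable X](_ : _ = (fun w => f w - c == 0) @^-1` [set true]).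
  by rewrite -[X in measurable X]setTI; exact: (m0 measurableT).
by apply/seteqP; split=> w /=; rewrite subr_eq0 => /eqP.
Qed.

End zf_measurable.

(** * Bounds on the error probability *)

Section error_bounds.
Context (R : realType) (d : measure_display) (T : measurableType d).
Variable P : probability T R.
Local Notation C := R[i].
Import Normc.

Lemma probability_bigcup_ub n (F : 'I_n -> set T) (c : R) :
  (forall i, measurable (F i)) -> (forall i, (P (F i) <= c%:E)%E) ->
  (P (\bigcup_i F i) <= (n%:R * c)%:E)%E.
Proof.
move=> mF Fc.
rewrite (_ : \bigcup_i F i = \big[setU/set0]_(i < n) F i); last first.
  by rewrite -bigcup_seq; apply/seteqP; split=> w [i _ Fi]; exists i => //=;
    rewrite mem_index_enum.
rewrite (_ : n%:R * c = \sum_(i < n) c);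
  last by rewrite sumr_const card_ord mulr_natl.
elim: (index_enum _) => [|i s IH]; first by rewrite !big_nil measure0.
rewrite !big_cons EFinD.
have mU : measurable (\big[setU/set0]_(j <- s) F j)
  by exact: bigsetU_measurable.
by apply: (le_trans (measureU2 _ (mF i) mU)); exact: (leeD (Fc i) IH).
Qed.

Variables (nu L : nat).
Hypothesis nuL : (nu < L)%N.
Variables (h : T -> nu.+1.-tuple C) (x n : T -> L.-tuple C).
Hypotheses (mh : measurable_fun setT h) (mx : measurable_fun setT x)
  (mn : measurable_fun setT n).
Hypotheses (ih : iid_CN01 P h) (inn : iid_CN01 P n).
Variables (l : 'I_L) (a b : C).
Hypothesis ab : a != b.

Let D : R := normc (a - b).

Let D0 : 0 < D.
Proof.
rewrite lt_neqAle normc_ge0 andbT eq_sym;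
  apply: contraNneq ab => /eq0_normc/eqP.
by rewrite subr_eq0.
Qed.

Let Er snr : set T := pairwise_error snr h x n l a b.
Let E : set T := [set w | tnth (x w) l = a].

Lemma measurable_pairwise_error snr : measurable (Er snr).
Proof. exact: measurable_error. Qed.

Lemma measurable_sent : measurable E.
Proof.
apply: measurable_complex_eq; exact: (measurableT_comp (measurable_tnth l) mx).
Qed.

Let peak := normal_peak (cn_sd R).

Lemma error_ub : exists C1 C2 : R, [/\ 0 < C1, 0 <= C2 & forall snr, 1 < snr ->
  (P (Er snr `&` E) <= ((C1 + C2 * ln snr) / snr)%:E)%E].
Proof.
have [r [K [K0 r1 HK]]] := invmx_Heq_norm R nuL.
have [Kt Kt0 tail] := normal_prob_tail R.
have L0 : 0 < L%:R :> R by rewrite ltr0n (leq_ltn_trans _ nuL).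
(* Chosen so that, for [rho = kap * al / t], the noise bound [K / rho * (L * (2 * al))] is exactly
   [t * D / 2]. *)
pose kap := 4 * K * L%:R / D.
have kap0 : 0 < kap by rewrite divr_gt0// mulr_gt0// mulr_gt0.
(* The first constant collects the real and imaginary tails of the [L] noise coordinates, the second
   the small discs of the [L] eigenvalues. *)
exists (L%:R * (2 * Kt)), (L%:R * (peak * 2 * kap) ^+ 2 * 2); split.
- by rewrite !mulr_gt0.
- by apply: mulr_ge0 => //; apply: mulr_ge0; [exact: ltW|exact: sqr_ge0].
move=> snr snr1; have snr0 : 0 < snr by lra.
have ln0 : 0 < ln snr by rewrite ln_gt0.
(* The tail factor [expR (- (al ^+ 2 / 2))] becomes [1 / snr]. *)
pose al := Num.sqrt (2 * ln snr).
have al0 : 0 < al by rewrite sqrtr_gt0 mulr_gt0.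
have alE : al ^+ 2 = 2 * ln snr by rewrite sqr_sqrtr// mulr_ge0// ltW.
pose t := Num.sqrt snr.
have t0 : 0 < t by rewrite sqrtr_gt0.
have tE : t ^+ 2 = snr by rewrite sqr_sqrtr// ltW.
pose rho := kap * al / t.
have rho0 : 0 < rho by rewrite divr_gt0// mulr_gt0.
pose B1 (k : 'I_L) := [set w | normc (spectrum (h w) (r k)) < rho].
pose Tl : set R := [set u | al < `|u|].
have mTl : measurable Tl.
  have m : measurable_fun setT (fun x : R => al < `|x|)
    by apply: measurable_fun_ltr.
  by rewrite -[X in measurable X]setTI; exact: (m measurableT [set true]).
pose B2 (i : 'I_L) := [set w | cbox Tl setT (tnth (n w) i)] `|` [set w | cbox
  setT Tl (tnth (n w) i)].
have mB1 k : measurable (B1 k) by apply: measurable_normc_lt;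
  exact: measurable_spectrum.
have mcb I J i : measurable I -> measurable J ->
  measurable [set w | cbox I J (tnth (n w) i)].
  move=> mI mJ; rewrite -[X in measurable X]setTI.
  by apply: (measurable_iid_tnth mn i measurableT); exact: measurable_cbox.
have mB2 i : measurable (B2 i) by apply: measurableU; exact: mcb.
have PB1 k : (P (B1 k) <= ((peak * 2 * kap) ^+ 2 * 2 * ln snr / snr)%:E)%E.
  apply: (le_trans (spectrum_ball_ub mh ih (r k) rho0)).
  rewrite lee_fin le_eqVlt; apply/orP; left; apply/eqP.
  have lnE : ln snr = al ^+ 2 / 2 by rewrite alE; field.
  rewrite lnE -[X in _ / X]tE /rho -/peak -mulr_natr.
  by field; exact: lt0r_neq0.
have PB2 i : (P (B2 i) <= (2 * Kt / snr)%:E)%E.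
  have NT := tail al (ltW al0).
  rewrite alE mulrAC mulfV ?pnatr_eq0// mul1r expRN lnK ?posrE// in NT.
  have e1 : (P [set w | cbox Tl setT (tnth (n w) i)] <= (Kt / snr)%:E)%E.
    by rewrite (iid_box inn)// probability_setT mule1.
  have e2 : (P [set w | cbox setT Tl (tnth (n w) i)] <= (Kt / snr)%:E)%E.
    by rewrite (iid_box inn)// probability_setT mul1e.
  rewrite (_ : 2 * Kt / snr = Kt / snr + Kt / snr); last by ring.
  apply: (le_trans (measureU2 _ (mcb _ _ i mTl measurableT) (mcb _ _ i
    measurableT mTl))).
  by rewrite EFinD; exact: (leeD e1 e2).
apply: (@le_trans _ _ (P (\bigcup_k B1 k `|` \bigcup_i B2 i))).
  rewrite le_measure ?inE//.
  - by apply: measurableI; [exact: measurable_pairwise_error|exact: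
    measurable_sent].
  - by apply: measurableU; apply: fin_bigcup_measurable.
  (* Off all bad events the noise is at most [t * D / 2], contrary to [errset_noise]. *)
  move=> w [Hw xw]; apply: contrapT => /not_orP[N1 N2].
  have lamge k : rho <= normc (spectrum (h w) (r k)).
    by rewrite leNgt; apply/negP => Hk; apply: N1; exists k.
  have nle i : normc (tnth (n w) i) <= 2 * al.
    have Hi : ~ B2 i w by move=> Hi; apply: N2; exists i.
    apply: (le_trans (normc_le _)); rewrite mulr_natl mulr2n.
    rewrite lerD// leNgt; apply/negP => HH; apply: Hi; [left|right]; split=> //.
  have [uH Hn] := HK (h w) rho rho0 lamge.
  have := errset_noise (h := h w) (x := x w) (n := n w) (ltW snr0) uH xw Hw.
  apply/negP; rewrite -leNgt -/D -/t.
  have := Hn (\col_i tnth (n w) i) (rev_ord l);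
    rewrite -/(noise (h w) (n w) l) => Hn'.
  have Sle : \sum_j normc ((\col_i tnth (n w) i) j 0) <= L%:R * (2 * al).
    rewrite (_ : L%:R * _ = \sum_(j < L) 2 * al);
      last by rewrite sumr_const card_ord mulr_natl.
    by rewrite ler_sum// => j _; rewrite mxE.
  have : normc (noise (h w) (n w) l) <= K / rho * (L%:R * (2 * al)).
    by rewrite (le_trans Hn')// ler_wpM2l// divr_ge0// ltW.
  rewrite (_ : K / rho * _ = t * D / 2); first by lra.
  rewrite /rho /kap; field.
  by rewrite !gt_eqF//.
rewrite (le_trans (measureU2 _ _ _))//; try by apply: fin_bigcup_measurable.
apply: (le_trans (leeD (probability_bigcup_ub mB1 PB1) (probability_bigcup_ub
  mB2 PB2))).
rewrite -EFinD lee_fin le_eqVlt; apply/orP; left; apply/eqP.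
by field; exact: lt0r_neq0.
Qed.


(** A singular circulant has an eigenvalue smaller than any given [rho > 0], an event of probability
    [O(rho^2)] by the union bound. *)
Lemma Heq_singular_null : P [set w | Heq L (h w) \notin unitmx] = 0%E.
Proof.
have [r [K [K0 r1 HK]]] := invmx_Heq_norm R nuL.
set Sg := [set w | _].
have mSg : measurable Sg.
  have m := measurable_unitmx (@measurable_Heq R nu L _ T h mh).
  rewrite (_ : Sg = (fun w => Heq L (h w) \in unitmx) @^-1` [set false]).
    by rewrite -[X in measurable X]setTI; exact: (m measurableT).
  by apply/seteqP; split=> w; rewrite /Sg /=; case: (_ \in _).
pose M := L%:R * (peak * 2) ^+ 2.
have M0 : 0 <= M by rewrite mulr_ge0// sqr_ge0.
have ub rho : 0 < rho -> (P Sg <= (M * rho ^+ 2)%:E)%E.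
  move=> rho0.
  pose B1 (k : 'I_L) := [set w | normc (spectrum (h w) (r k)) < rho].
  have mB1 k : measurable (B1 k) by apply: measurable_normc_lt;
    exact: measurable_spectrum.
  apply: (@le_trans _ _ (P (\bigcup_k B1 k))).
    rewrite le_measure ?inE//; first exact: fin_bigcup_measurable.
    move=> w /= Hw; apply: contrapT => N1; move/negP : Hw; apply.
    apply: (HK (h w) rho rho0 _).1 => k.
    by rewrite leNgt; apply/negP => Hk; apply: N1; exists k.
  apply: (le_trans (probability_bigcup_ub mB1 (fun k =>
    spectrum_ball_ub mh ih (r k) rho0))).
  by rewrite lee_fin -/peak le_eqVlt; apply/orP; left; apply/eqP; rewrite /M;
    ring.
have fP : P Sg \is a fin_num by exact: fin_num_measure.
rewrite -(fineK fP); congr (_%:E); apply/eqP;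
  rewrite eq_le fine_ge0// andbT leNgt.
apply/negP => p0; set p := fine (P Sg) in p0.
(* The minimum with [1] gives [rho ^+ 2 <= rho], and the other term then gives
   [M * rho ^+ 2 < p]. *)
pose rho := Num.min 1 (p / (2 * (M + 1))).
have q0 : 0 < p / (2 * (M + 1)) by rewrite divr_gt0// mulr_gt0// ltr_wpDl.
have rho0 : 0 < rho by rewrite lt_min ltr01.
have rho1 : rho <= 1 by rewrite ge_min lexx.
have rho2 : rho * (2 * (M + 1)) <= p.
  by rewrite -ler_pdivlMr ?ge_min ?lexx ?orbT// mulr_gt0// ltr_wpDl.
have := ub rho rho0; rewrite -(fineK fP) lee_fin -/p leNgt => /negP; apply.
have : M * rho ^+ 2 <= M * rho by rewrite ler_wpM2l// expr2 ler_piMr// ltW.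
by nra.
Qed.

Hypothesis n_hx : independent P n (fun w => (h w, x w)).
Hypothesis x_h : independent P x h.

Lemma error_lb : exists c s0 : R, [/\ 0 < c, 1 < s0 & forall snr, s0 <= snr ->
  ((c / snr)%:E * P E <= P (Er snr `&` E))%E].
Proof.
have [c c0 Hc] := spectrum1_ball_lb mh ih.
(* Lower bound for the mass of [[1, 2]] and of [[-2, -1]], each of length [1]. *)
pose q : R := pdf_low 2 * 1.
have q0 : 0 < q by rewrite /q mulr1 pdf_low_gt0.
(* The probability of the noise box times that of a small [spectrum h 1], where
   [rho ^+ 2 = 4 / D ^+ 2 / snr]. The threshold on [snr] makes [rho <= 1]. *)
exists ((q * q) ^+ L * (c * (4 / D ^+ 2))), (2 + 4 / D ^+ 2).
have D2 : 0 < 4 / D ^+ 2 by rewrite divr_gt0// exprn_gt0.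
split; [|by lra|].
  by apply: mulr_gt0; [apply: exprn_gt0; exact: mulr_gt0|exact: mulr_gt0].
move=> snr snr_ge; have snr0 : 0 < snr by lra.
pose t := Num.sqrt snr.
have t0 : 0 < t by rewrite sqrtr_gt0.
have tE : t ^+ 2 = snr by rewrite sqr_sqrtr// ltW.
pose rho := 2 / (t * D).
have rho0 : 0 < rho by rewrite divr_gt0// mulr_gt0.
have rhoE : rho ^+ 2 = 4 / D ^+ 2 / snr.
  by rewrite -tE /rho; field; rewrite !gt_eqF.
have rho1 : rho <= 1.
  have : rho ^+ 2 <= 1 by rewrite rhoE ler_pdivrMr//; lra.
  by nra.
pose hx w := (h w, x w).
have mhx : measurable_fun setT hx by exact: measurable_fun_pair.
pose G1 : set (nu.+1.-tuple C) :=
  [set u | Heq L u \in unitmx /\ normc (spectrum u 1) < rho].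
have mid : measurable_fun [set: nu.+1.-tuple C] id by exact: measurable_id.
have mU : measurable [set u : nu.+1.-tuple C | Heq L u \in unitmx].
  have m := measurable_unitmx (@measurable_Heq R nu L _ _ id mid).
  by rewrite -[X in measurable X]setTI; exact: (m measurableT [set true]).
have mBl : measurable [set u : nu.+1.-tuple C | normc (spectrum u 1) < rho].
  by apply: measurable_normc_lt; exact: measurable_spectrum.
have mG1 : measurable G1 by exact: measurableI.
pose Gx : set (L.-tuple C) := [set u | tnth u l = a].
have mGx : measurable Gx.
  by apply: measurable_complex_eq; exact: measurable_tnth.
pose G : set (nu.+1.-tuple C * L.-tuple C) := G1 `*` Gx.
have mG : measurable G by exact: measurableX.
pose Cs : set ((nu.+1.-tuple C * L.-tuple C) * L.-tuple C) :=
  errset snr a b l `&` [set z | Gx z.1.2].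
have mCs : measurable Cs.
  apply: measurableI.
    apply: measurable_error.
    - exact: (measurableT_comp measurable_fst measurable_fst).
    - exact: (measurableT_comp measurable_snd measurable_fst).
    - exact: measurable_snd.
  have m := measurableT_comp (@measurable_snd _ _ (nu.+1.-tuple C) (L.-tuple C))
    (@measurable_fst _ _ (nu.+1.-tuple C * L.-tuple C)%type (L.-tuple C)).
  by rewrite -[X in measurable X]setTI; exact: (m measurableT Gx).
have key : (((q * q) ^+ L)%:E * P (hx @^-1` G) <= P [set w | Cs (hx w, n w)])%E.
  apply: (independent_section_lb mhx mn (independentC n_hx)) => //.
    by rewrite lee_fin exprn_ge0// mulr_ge0// ltW.
  move=> [u y] [[uU ul] /= yl].
  (* Coefficients of the noise in the linear form of [errset_sign]; their moduli sum to [D] times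
     the l1-norm of the row. *)
  pose g i := invmx (Heq L u) (rev_ord l) i * conjc (a - b).
  pose pos : set R := `[1, 2]%classic; pose neg : set R := `[-2, -1]%classic.
  have Npos : (q%:E <= normal_prob 0 (cn_sd R) pos)%E.
    by apply: le_trans (normal_prob_lb (m := 2) _ _ _); [|lra|lra|lra];
      rewrite lee_fin /q ler_wpM2l ?(ltW (pdf_low_gt0 _))//; lra.
  have Nneg : (q%:E <= normal_prob 0 (cn_sd R) neg)%E.
    by apply: le_trans (normal_prob_lb (m := 2) _ _ _); [|lra|lra|lra];
      rewrite lee_fin /q ler_wpM2l ?(ltW (pdf_low_gt0 _))//; lra.
  have mpos : measurable pos by exact: measurable_itv.
  have mneg : measurable neg by exact: measurable_itv.
  (* On this product of squares, [Re (g i * n_i) <= - |g i|] for every [i]. *)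
  pose I i := if 0 <= complex.Re (g i) then neg else pos.
  pose J i := if 0 <= complex.Im (g i) then pos else neg.
  apply: (le_trans (@iid_box_vec _ _ _ P _ n inn I J q (ltW q0) _ _ _ _)).
  - by move=> i; rewrite /I; case: ifP.
  - by move=> i; rewrite /J; case: ifP.
  - by move=> i; rewrite /I; case: ifP.
  - by move=> i; rewrite /J; case: ifP.
  rewrite le_measure ?inE//.
  - rewrite -[X in measurable X]setTI; apply: (mn measurableT).
    by apply: measurable_box_vec => i; rewrite /I /J; case: ifP.
  - have m : measurable_fun setT (fun w => ((u, y), n w))
    by apply: measurable_fun_pair.
    by rewrite -[X in measurable X]setTI; exact: (m measurableT Cs).
  move=> w /= Hw; split; last by [].
  apply: errset_sign => //.
  have -> : noise u (n w) l * conjc (a - b) = \sum_i g i * tnth (n w) i.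
    rewrite /noise mxE mulr_suml; apply: eq_bigr => i _.
    by rewrite !mxE /g; ring.
  have S1 := invmx_Heq_row_lb nuL (rev_ord l) uU.
  set Sg := \sum_j _ in S1.
  have S0 : 0 <= Sg by rewrite sumr_ge0// => i _; exact: normc_ge0.
  (* The row bound and [spectrum u 1] below [rho] give [1 < rho * Sg], and [t * D / 2] is
     [rho^-1]. *)
  have Sgt : t * D / 2 < Sg.
    have : 1 < rho * Sg.
      have Sp : 0 < Sg.
        by rewrite lt_neqAle S0 andbT eq_sym; apply: contraTneq S1 => ->;
          rewrite mulr0 -ltNge ltr01.
      by rewrite (le_lt_trans S1)// ltr_pM2r.
    rewrite -(ltr_pdivrMl _ _ rho0) mulr1 /rho invf_div; exact.
  apply: (@le_lt_trans _ _ (- (D * Sg))); last first.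
    rewrite ltrN2 -/D -/t (_ : t * D ^+ 2 / 2 = D * (t * D / 2)); last by field.
    by rewrite ltr_pM2l.
  rewrite raddf_sum/= mulr_sumr -sumrN ler_sum// => i _.
  have -> : D * normc (invmx (Heq L u) (rev_ord l) i) = normc (g i).
    rewrite /g normcM mulrC; congr (_ * _); rewrite /D;
      case: (a - b) => c1 c2 /=.
    by rewrite sqrrN.
  have := Hw i; rewrite /cbox /I /J /=.
  (* The modulus of [g i] is at most the sum of its absolute coordinates, while the noise
     coordinates have absolute value at least [1] and signs making both terms of the real part
     negative or zero. *)
  have := normc_le (g i).
  case: (g i) (tnth (n w) i) => [g1 g2] [n1 n2] /= gle [].
  case: ifP => [g10|/negbT]; last rewrite -ltNge => g10;
    case: ifP => [g20|/negbT]; try rewrite -ltNge => g20.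
  - rewrite /neg /pos /= !in_itv/= => /andP[h1 h2] /andP[h3 h4].
    by rewrite !ger0_norm// in gle; nra.
  - rewrite /neg /pos /= !in_itv/= => /andP[h1 h2] /andP[h3 h4].
    by rewrite ger0_norm// (ltr0_norm g20) in gle; nra.
  - rewrite /neg /pos /= !in_itv/= => /andP[h1 h2] /andP[h3 h4].
    by rewrite (ger0_norm g20) (ltr0_norm g10) in gle; nra.
  - rewrite /neg /pos /= !in_itv/= => /andP[h1 h2] /andP[h3 h4].
    by rewrite (ltr0_norm g20) (ltr0_norm g10) in gle; nra.
have CsE : [set w | Cs (hx w, n w)] = Er snr `&` E by apply/seteqP; split.
rewrite CsE in key; apply: (le_trans _ key).
have -> : hx @^-1` G = x @^-1` Gx `&` h @^-1` G1 by apply/seteqP; split=> w [].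
rewrite x_h// (_ : x @^-1` Gx = E)//.
rewrite (_ : _ / snr = (q * q) ^+ L * (c * rho ^+ 2)); last by rewrite rhoE;
  field; rewrite !gt_eqF.
have qL0 : (0 <= ((q * q) ^+ L)%:E)%E by rewrite lee_fin exprn_ge0// mulr_ge0//
  ltW.
rewrite EFinM -muleA; apply: lee_wpmul2l => //; rewrite muleC.
apply: lee_wpmul2l => //; rewrite (le_trans (Hc rho rho0 rho1))//.
have mS : measurable [set w | Heq L (h w) \notin unitmx].
  rewrite (_ : [set w | _] = ~` (h @^-1` [set u | Heq L u \in unitmx])).
    by apply: measurableC; rewrite -[X in measurable X]setTI;
      exact: (mh measurableT).
  by apply/seteqP; split=> w /= /negP.
have mhG : measurable (h @^-1` G1).
  by rewrite -[X in measurable X]setTI; exact: (mh measurableT).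
(* The invertibility required in [G1] costs only a null set. *)
apply: (@le_trans _ _ (P (h @^-1` G1 `|` [set w | Heq L (h w) \notin unitmx]))).
  rewrite le_measure ?inE//.
  - by apply: measurable_normc_lt; exact: measurable_spectrum.
  - exact: measurableU.
  - by move=> w /= Hw; have [uw|uw] := boolP (Heq L (h w) \in unitmx);
    [left|right].
apply: (le_trans (measureU2 _ mhG mS)).
by rewrite [X in (_ + X <= _)%E]Heq_singular_null adde0.
Qed.

End error_bounds.

(** * From two-sided bounds to the exponent *)

Section exponent.
Context (R : realType).

(** [ln (f snr) + ln snr] lies between a constant and a constant plus [ln (ln snr)], both negligible
    against [ln snr]; the logarithmic factor does not affect the exponent. *)
Lemma exponential_order_bounds (f : R -> R) (c C1 C2 s0 : R) :
  0 < c -> 0 < C1 -> 0 <= C2 ->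
  (forall snr, s0 <= snr -> c / snr <= f snr <= (C1 + C2 * ln snr) / snr) ->
  exponential_order f (- 1).
Proof.
move=> c0 C10 C20 Hf; rewrite /exponential_order; apply/cvgrPdist_le => e e0.
pose M := C1 + C2.
have M0 : 0 < M by rewrite ltr_pwDl.
pose K := `|ln c| + `|ln M|.
near=> snr.
have s0le : s0 <= snr by near: snr; apply: nbhs_pinfty_ge; exact: num_real.
have lnge Y : expR Y <= snr -> Y <= ln snr.
  by move=> H; rewrite -[Y]expRK ler_ln ?posrE ?expR_gt0 ?(lt_le_trans
    (expR_gt0 _) H).
have y1 : 1 <= ln snr by apply: lnge; near: snr; apply: nbhs_pinfty_ge;
  exact: num_real.
(* This threshold absorbs the constants into half of [e * ln snr]; the next one absorbs
   [ln (ln snr)] into the other half. *)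
have yK : 2 * K / e <= ln snr by apply: lnge; near: snr; apply: nbhs_pinfty_ge;
  exact: num_real.
have ye : (4 / e) ^+ 2 <= ln snr by apply: lnge; near: snr;
  apply: nbhs_pinfty_ge; exact: num_real.
(* [ln] is [0] on nonpositive numbers, which contradicts [y1]. *)
have snr0 : 0 < snr by rewrite ltNge; apply/negP => /ln0 E;
  rewrite E ler10 in y1.
have /andP[fl fu] := Hf snr s0le.
set y := ln snr in y1 yK ye fu *.
have y0 : 0 < y by lra.
have f0 : 0 < f snr by rewrite (lt_le_trans _ fl)// divr_gt0.
have yV : - y = ln snr^-1 by rewrite lnV ?posrE.
have sV0 : 0 < snr^-1 by rewrite invr_gt0.
have low : ln c - y <= ln (f snr).
  by rewrite yV -lnM ?posrE// ler_ln ?posrE// mulr_gt0.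
have up : ln (f snr) <= ln M + ln y - y.
  have My0 : 0 < M * y by rewrite mulr_gt0.
  rewrite -lnM ?posrE// yV -lnM ?posrE//.
  rewrite ler_ln ?posrE ?mulr_gt0// (le_trans fu)// ler_pM2r//.
  by rewrite /M mulrDl lerD// ler_peMr// ltW.
(* From [ln z <= z - 1] at the square root of [y]. *)
have sy : ln y <= 2 * Num.sqrt y.
  have sq0 : 0 < Num.sqrt y by rewrite sqrtr_gt0.
  rewrite -{1}(sqr_sqrtr (ltW y0)) lnXn// mulr2n.
  have : ln (Num.sqrt y) <= Num.sqrt y - 1.
    rewrite [in leLHS](_ : Num.sqrt y = 1 + (Num.sqrt y - 1)); last by ring.
    by apply: le_ln1Dx; lra.
  by lra.
have sye : 4 <= e * Num.sqrt y.
  have : 4 / e <= Num.sqrt y.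
    have q0 : 0 <= 4 / e by rewrite divr_ge0// ltW.
    by rewrite -(ger0_norm q0) -sqrtr_sqr ler_wsqrtr.
  by rewrite ler_pdivrMr// mulrC.
have sye2 : 2 * Num.sqrt y <= e * y / 2.
  have yE := sqr_sqrtr (ltW y0); have sq0 := sqrtr_ge0 y.
  rewrite -[in leRHS]yE; nra.
have Ky : 2 * K <= e * y by rewrite (mulrC e) -ler_pdivrMr.
have lc := ler_norm (- ln c); rewrite normrN in lc.
have lM := ler_norm (ln M).
have [nc nM] : 0 <= `|ln c| /\ 0 <= `|ln M| by [].
rewrite (_ : - 1 - _ = - ((ln (f snr) + y) / y)); last first.
  by field; exact: lt0r_neq0.
rewrite normrN normrM normfV (gtr0_norm y0) ler_pdivrMr// ler_norml.
by rewrite /K in Ky; apply/andP; split; lra.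
Unshelve. all: by end_near. Qed.

End exponent.

Theorem theorem4 (R : realType) (d : measure_display) (T : measurableType d)
    (P : probability T R) (nu L : nat) (rate : R) (M : nat)
    (s : 'I_M -> R[i])
    (h : {RV P >-> nu.+1.-tuple R[i]})
    (x : {RV P >-> L.-tuple R[i]})
    (n : {RV P >-> L.-tuple R[i]})
    (l : 'I_L) (j k : 'I_M) :
  (1 <= nu)%N -> (nu.+1 <= L)%N ->
  0 < rate -> M%:R = 2 `^ rate -> injective s ->
  iid_CN01 P h ->
  iid_CN01 P n ->
  (forall w i, exists m, tnth (x w) i = s m) ->
  (forall i, ('E_P[(fun w => complex.Re (`|tnth (x w) i| ^+ 2))%R] = 1)%E) ->
  independent P n (fun w => (h w, x w)) ->
  independent P x h ->
  j != k ->
  (0 < P [set w | tnth (x w) l = s j])%E ->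
  diversity_gain (Perr P h x n l (s j) (s k)) 1 /\
  exponentially_equal (Perr P h x n l (s j) (s k)) (fun snr => snr^-1).
Proof.
move=> _ nuL _ _ sinj ih inn _ _ n_hx x_h jk PE0.
have sjk : s j != s k by apply: contra_neq jk; exact: sinj.
have mh : measurable_fun setT h by exact: measurable_funPT.
have mx : measurable_fun setT x by exact: measurable_funPT.
have mn : measurable_fun setT n by exact: measurable_funPT.
pose E := [set w | tnth (x w) l = s j].
have mE : measurable E by exact: measurable_sent.
pose p := fine (P E).
have pE : P E = p%:E by rewrite fineK// fin_num_measure.
have p0 : 0 < p by rewrite -lte_fin -pE.
(* Averaging over the channel turns [Perr] into an elementary conditional probability given the sent
   symbol, because the input is independent of the channel. *)
have PerrE snr : (Perr P h x n l (s j) (s k) snr)%:E =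
    (P (pairwise_error snr h x n l (s j) (s k) `&` E) * p^-1%:E)%E.
  have mA : measurable (pairwise_error snr h x n l (s j) (s k))
    by exact: measurable_pairwise_error.
  have mB : measurable [set u : L.-tuple R[i] | tnth u l = s j].
    by apply: measurable_complex_eq; exact: measurable_tnth.
  have := expectation_cond_prob x_h mA mB PE0.
  rewrite -/E pE /Perr => <-.
  have fA : P (pairwise_error snr h x n l (s j) (s k) `&` E) \is a fin_num.
    by rewrite fin_num_measure//; exact: measurableI.
  have := expectation_cond_prob x_h mA mB PE0; rewrite -/E pE => EE.
  rewrite -EE in fA; rewrite -muleA -EFinM mulfV ?gt_eqF// mule1 fineK//.
  (* [fine] loses nothing: an infinite expectation times [p > 0] would be infinite. *)
  move: fA; case: ('E_P[_])%E => [//| |].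
    by rewrite gt0_mulye// lte_fin.
  by rewrite gt0_mulNye// lte_fin.
have [C1 [C2 [C10 C20 ub]]] := error_ub nuL mh mx mn ih inn l sjk.
have [c [s0 [c0 s01 lb]]] := error_lb nuL mh mx mn ih inn l sjk n_hx x_h.
have Hord : exponential_order (Perr P h x n l (s j) (s k)) (- 1).
  (* The lower bound already carries the factor [P E], so only the upper constants are divided by
     [p]. *)
  apply: (@exponential_order_bounds _ _ c (C1 / p) (C2 / p) s0) => //.
  - exact: divr_gt0.
  - by rewrite divr_ge0// ltW.
  move=> snr ssnr; have snr0 : 0 < snr by lra.
  rewrite -!lee_fin PerrE; apply/andP; split.
    have H : ((c / snr)%:E * p%:E <= P (pairwise_error snr h x n l (s j) (s k)
      `&` E))%E.
      by rewrite -pE; exact: lb.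
    rewrite -(mulfK (lt0r_neq0 p0) (c / snr)).
    by rewrite EFinM lee_wpmul2r// ?lee_fin ?invr_ge0 ?ltW// EFinM.
  have H := ub snr (lt_le_trans s01 ssnr).
  rewrite (_ : _ / snr = (C1 + C2 * ln snr) / snr * p^-1); last first.
    by field; rewrite !gt_eqF.
  by rewrite [leRHS]EFinM lee_wpmul2r// lee_fin invr_ge0 ltW.
split=> //; exists (- 1); split => //.
apply: (@exponential_order_bounds _ _ 1 1 0 2) => // snr _.
by rewrite mul0r addr0 mul1r lexx.
Qed.
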